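(* Let $\mathcal{A}=\mathcal{A}(p;q)$ be a regular generalized Weyl algebra over $\mathbb{K}$ with parameter $q$ not a root of unity, let $(\Omega,d)$ be the first-order differential calculus on $\mathcal{A}$ described in the context, let $\mathfrak{I}=\operatorname{Hom}_{\mathcal{A}}(\Omega,\mathcal{A})$ be the space of right $\mathcal{A}$-linear maps $\Omega\to\mathcal{A}$, and set $n=\deg(p(z))$. Define $$\operatorname{div}:\mathfrak{I}\to\mathcal{A},\qquad \xi\mapsto q^{-2}\partial_-(\xi(\omega_-))+\partial_0(\xi(\omega_0))+q^2\partial_+(\xi(\omega_+)).$$ (1) The map $\operatorname{div}$ is the unique divergence such that $\operatorname{div}(\xi_i)=0$ for $i=-,0,+$, where the $\xi_i$ form the basis of $\mathfrak{I}$ dual to the $\omega_i$, i.e. $\xi_i(\omega_j)=\delta_{ij}$, $i,j\in\{-,0,+\}$. (2) The integral $\Lambda$ associated to $\operatorname{div}$ vanishes on every element of the linear basis of $\mathcal{A}(p;q)$ consisting of the monomials $x_-^rz_+^mz_-^l$ and $x_+^rz_+^mz_-^l$ ($r,m,l\in\mathbb{N}$), except for those lying in the subalgebra $\mathbb{K}[z]$ generated by $z=z_+z_-$ (i.e. the powers of $z$), and on this subalgebra it satisfies, for all $f(z)\in\mathbb{K}[z]$, $$\Lambda\big(q^2p(q^2z)f(q^2z)\big)=\Lambda\big(p(z)f(z)\big).$$ (3) The integral space associated to $\operatorname{div}$ is $n$-dimensional with basis $v_i:=\Lambda(z^i)$, $i=0,1,\dots,n-1$. Furthermore, for all $k\in\mathbb{N}$,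 $$\Lambda(z^{n+k})=\sum_{i=0}^{n-1}\frac{[i+1]}{[n+k+1]}\beta_i^k\,v_i,$$ where $[l]:=\frac{1-q^{2l}}{1-q^2}=1+q^2+\cdots+q^{2l-2}$ and the coefficients $\beta_i^k$ are determined by the following recurrence: writing the monic polynomial $\hat p(z)$ associated to $p(z)$ as $\hat p(z)=z^n-\sum_{i=0}^{n-1}\mu_iz^i$, $$\beta_i^k=\sum_{j=1}^n\mu_{n-j}\beta_i^{k-j}+\mu_{i-k},\qquad \mu_l=\beta_i^l=0\ \text{ if } l<0.$$
   Context: All algebras are associative and unital over a field $\mathbb{K}$ of characteristic $0$; $q\in\mathbb{K}$, $q\ne0$, and $p$ is a polynomial in one variable over $\mathbb{K}$. $\mathbb{N}$ contains $0$. $p_{q^2}(z):=\frac{p(q^2z)-p(z)}{(q^2-1)z}$ is the $q^2$-derivative of $p$. The polynomial $p$ is $q^2$-separable if $p(z)$ is coprime with $zp_{q^2}(z)$ (in particular $p(0)\ne 0$). $\mathcal{A}(p;q)$ is the algebra generated by $x_+,x_-,z_+,z_-$ subject to the relations $$z_+z_-=z_-z_+,\quad x_+z_\pm=q^{-1}z_\pm x_+,\quad x_-z_\pm=q z_\pm x_-,\quad x_+x_-=p(z_+z_-),\quad x_-x_+=p(q^2z_-z_+).$$ It is called regular if $p$ is $q^2$-separable. It is $\mathbb{Z}$-graded by $|z_\pm|=|x_\pm|=\pm1$. Define algebra automorphisms of $\mathcal{A}(p;q)$ on homogeneous elements by $\sigma_\pm(a)=q^{|a|}a$, $\sigma_0(a)=q^{2|a|}a$.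 Put $z=z_+z_-$ and $c(z)=q\,p_{q^2}(z)$. Fix nonzero scalars $\alpha_0,\alpha_+,\alpha_-\in\mathbb{K}$. The linear maps $\partial_i$, $i\in\{-,0,+\}$, are the skew $\sigma_i$-derivations of $\mathcal{A}(p;q)$ (i.e. $\partial_i(ab)=\partial_i(a)\sigma_i(b)+a\partial_i(b)$) given on generators by - $\partial_0(x_+)=\alpha_0x_+$, $\partial_0(x_-)=-q^{-2}\alpha_0x_-$, $\partial_0(z_+)=\alpha_0z_+$, $\partial_0(z_-)=-q^{-2}\alpha_0z_-$; - $\partial_-(x_+)=\partial_-(z_+)=0$, $\partial_-(x_-)=\alpha_-c(z)z_+$, $\partial_-(z_-)=\alpha_-x_+$; - $\partial_+(x_-)=\partial_+(z_-)=0$, $\partial_+(x_+)=\alpha_+c(z)z_-$, $\partial_+(z_+)=\alpha_+x_-$. The calculus $(\Omega,d)$: $\Omega$ is the free left $\mathcal{A}(p;q)$-module with basis $\omega_-,\omega_0,\omega_+$ and right action determined by $\omega_ia=\sigma_i(a)\omega_i$ (so $\Omega$ is also free as a right module on the $\omega_i$), and $d(a)=\partial_-(a)\omega_-+\partial_0(a)\omega_0+\partial_+(a)\omega_+$. The space $\mathfrak{I}$ has left and right $\mathcal{A}$-actions $(a\cdot f\cdot b)(\omega):=af(b\omega)$ for $a,b\in\mathcal{A}$, $\omega\in\Omega$, $f\in\mathfrak{I}$. A divergence on $\mathcal{A}$ (relative to $(\Omega,d)$) is a linear map $\operatorname{div}:\mathfrak{I}\to\mathcal{A}$ such that $\operatorname{div}(\xi\cdot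 a)=\operatorname{div}(\xi)a+\xi(d(a))$ for all $a\in\mathcal{A}$, $\xi\in\mathfrak{I}$. The cokernel $\operatorname{coker}(\operatorname{div})=\mathcal{A}/\operatorname{Im}(\operatorname{div})$ is the integral space associated to $\operatorname{div}$, and the cokernel map $\Lambda:\mathcal{A}\to\operatorname{coker}(\operatorname{div})$ is the integral associated to $\operatorname{div}$. *)

(* Defs.v *)
From HB Require Import structures.
From mathcomp Require Import all_boot all_order all_algebra.
From mathcomp Require Import generic_quotient ring_quotient.
From mathcomp Require Import finmap boolp monalg.

Set Implicit Arguments.
Unset Strict Implicit.
Unset Printing Implicit Defensive.

Import GRing.Theory.

Local Open Scope ring_scope.
Local Open Scope quotient_scope.

Section Cokernel.
Variables (K : fieldType) (V W : lmodType K) (f : {linear V -> W}).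

Definition im_pred : {pred W} := fun w => `[< exists v, w = f v >].

Fact im_zmod_closed : zmod_closed im_pred.
Proof.
split=> [|x y]; first by apply/asboolP; exists 0; rewrite raddf0.
move=> /asboolP[u ->] /asboolP[v ->].
by apply/asboolP; exists (u - v); rewrite raddfB.
Qed.

HB.instance Definition _ := GRing.isZmodClosed.Build W im_pred im_zmod_closed.

Definition coker : Type := Quotient.quot im_pred.

HB.instance Definition _ := GRing.Zmodule.on coker.

Definition coker_map (w : W) : coker := \pi_(Quotient.quot im_pred) w.

Lemma coker_map_eqP w1 w2 :
  coker_map w1 = coker_map w2 <-> exists v, w1 - w2 = f v.
Proof.
rewrite /coker_map; split=> [/eqP|[v e]]; last apply/eqP.
  by rewrite -Quotient.idealrBE => /asboolP.
by rewrite -Quotient.idealrBE; apply/asboolP; exists v.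
Qed.

Lemma coker_map_surj c : exists w, c = coker_map w.
Proof. by exists (repr (c : Quotient.quot im_pred)); rewrite /coker_map reprK. Qed.

Fact coker_mapB : zmod_morphism coker_map.
Proof. by move=> x y; rewrite /coker_map raddfB. Qed.

HB.instance Definition _ := GRing.isZmodMorphism.Build W coker coker_map coker_mapB.

Definition coker_scale (k : K) (c : coker) : coker :=
  coker_map (k *: repr (c : Quotient.quot im_pred)).

Fact coker_scaleE k w : coker_scale k (coker_map w) = coker_map (k *: w).
Proof.
apply/coker_map_eqP; rewrite -scalerBr.
have [v ->] : exists v, repr (coker_map w : Quotient.quot im_pred) - w = f v.
  by apply/coker_map_eqP; rewrite /coker_map reprK.
by exists (k *: v); rewrite linearZ.
Qed.

Fact coker_scaleA a b v :
  coker_scale a (coker_scale b v) = coker_scale (a * b) v.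
Proof. by have [w ->] := coker_map_surj v; rewrite !coker_scaleE scalerA. Qed.

Fact coker_scale1 : left_id 1 coker_scale.
Proof.
by move=> v; have [w ->] := coker_map_surj v; rewrite coker_scaleE scale1r.
Qed.

Fact coker_scaleDr : right_distributive coker_scale +%R.
Proof.
move=> a u v; have [x ->] := coker_map_surj u; have [y ->] := coker_map_surj v.
by rewrite -raddfD !coker_scaleE scalerDr raddfD.
Qed.

Fact coker_scaleDl v : {morph coker_scale^~ v : a b / a + b}.
Proof.
move=> a b; have [x ->] := coker_map_surj v.
by rewrite !coker_scaleE scalerDl raddfD.
Qed.

HB.instance Definition _ := GRing.Zmodule_isLmodule.Build K coker
  coker_scaleA coker_scale1 coker_scaleDr coker_scaleDl.

Fact coker_mapZ : scalable coker_map.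
Proof. by move=> k w; rewrite -coker_scaleE. Qed.

HB.instance Definition _ :=
  GRing.isScalable.Build K W coker *:%R coker_map coker_mapZ.

End Cokernel.

(* I may be infinite: only finite linear combinations occur. *)
Definition linear_basis (K : fieldType) (V : lmodType K) (I : eqType)
    (e : I -> V) : Prop :=
  (forall (s : seq I) (c : I -> K),
      uniq s -> \sum_(i <- s) c i *: e i = 0 -> {in s, forall i, c i = 0})
  /\ (forall v, exists (s : seq I) (c : I -> K), v = \sum_(i <- s) c i *: e i).

Section QDerivative.
Variables (K : fieldType) (p : {poly K}) (q : K).

(* The numerator has no constant term, so the division is exact as soon as
   q ^+ 2 != 1. *)
Definition q2_deriv : {poly K} :=
  (p \Po (q ^+ 2 *: 'X) - p) %/ ((q ^+ 2 - 1) *: 'X).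

Definition q2_separable : Prop := coprimep p ('X * q2_deriv).

Definition q2_bracket (l : nat) : K := (1 - q ^+ (2 * l)) / (1 - q ^+ 2).

End QDerivative.

Definition free_alg (K : fieldType) (I : choiceType) : Type :=
  {malg K[{fmonom I}]}.

Section FreeAlgebra.
Variables (K : fieldType) (I : choiceType).
Notation F := (free_alg K I).
Notation M := {malg K[{fmonom I}]}.

HB.instance Definition _ := GRing.Lalgebra.on F.

Fact scale_malgU (k c : K) (m : {fmonom I}) :
  k *: << c *g m >> = << k * c *g m >> :> M.
Proof.
by apply/malgP=> m'; rewrite mcoeffZ (mcoeffU m c) (mcoeffU m (k * c)) mulrnAr.
Qed.

Fact free_scaleAr (k : K) (x y : F) : k *: (x * y) = x * (k *: y).
Proof.
suff h (u v : M) : k *: (u * v) = u * (k *: v) by exact: h.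
rewrite (malgMEw (fsubset_refl _) (msuppZ_le k v)) malgME scaler_sumr.
apply: eq_bigr => k1 _; rewrite scaler_sumr; apply: eq_bigr => k2 _.
by rewrite mcoeffZ mulrCA scale_malgU.
Qed.

HB.instance Definition _ := GRing.Lalgebra_isAlgebra.Build K F free_scaleAr.

Definition free_gen (i : I) : F := << fmu i >>.

Variables (B : algType K) (v : I -> B).

Definition free_mon (m : {fmonom I}) : B := \prod_(i <- m) v i.

Fact free_mon_mmorphism : mmorphism free_mon.
Proof.
by split=> [m1 m2|]; rewrite /free_mon ?fm1 ?big_nil // fmM big_cat.
Qed.

HB.instance Definition _ :=
  isMultiplicative.Build {fmonom I} B free_mon free_mon_mmorphism.

Definition free_lift : F -> B := mmap (in_alg B) free_mon.

Fact free_liftB : zmod_morphism free_lift.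
Proof. by move=> x y; rewrite /free_lift raddfB. Qed.

Fact free_liftM : monoid_morphism free_lift.
Proof.
have [h1 h2] : multiplicative free_lift; last by split.
apply: commr_mmap_is_multiplicative => g m m'.
by rewrite /GRing.comm /= mulr_algl mulr_algr.
Qed.

Fact free_liftZ : scalable free_lift.
Proof. by move=> k x; rewrite /free_lift mmapZ /= mulr_algl. Qed.

HB.instance Definition _ := GRing.isZmodMorphism.Build F B free_lift free_liftB.
HB.instance Definition _ := GRing.isMonoidMorphism.Build F B free_lift free_liftM.
HB.instance Definition _ :=
  GRing.isScalable.Build K F B *:%R free_lift free_liftZ.

Lemma free_lift_gen i : free_lift (free_gen i) = v i.
Proof.
by rewrite /free_lift mmapU /free_mon fmU big_seq1 /= scale1r mul1r.
Qed.

End FreeAlgebra.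

Inductive ideal_gen (R : nzRingType) (S : R -> Prop) : R -> Prop :=
| ideal_gen0 : ideal_gen S 0
| ideal_gen_rel u of S u : ideal_gen S u
| ideal_genD u v of ideal_gen S u & ideal_gen S v : ideal_gen S (u + v)
| ideal_genM a u b of ideal_gen S u : ideal_gen S (a * u * b).

Lemma lrmorph_horner_alg (K : fieldType) (B C : algType K)
    (f : {lrmorphism B -> C}) (b : B) (p : {poly K}) :
  f (horner_alg b p) = horner_alg (f b) p.
Proof.
elim/poly_ind: p => [|p c IHp]; first by rewrite !raddf0.
rewrite !rmorphD !rmorphM /= IHp !horner_algX !horner_algC.
by rewrite linearZ rmorph1.
Qed.

(* The relations u = 0 of A(p;q), for a quadruple x_+ = X true,
   x_- = X false, z_+ = Z true, z_- = Z false in an algebra B. *)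
Inductive gwa_rel (K : fieldType) (p : {poly K}) (q : K) (B : algType K)
    (X Z : bool -> B) : B -> Prop :=
| gwa_rel_zz : gwa_rel p q X Z (Z true * Z false - Z false * Z true)
| gwa_rel_xpz s : gwa_rel p q X Z (X true * Z s - q^-1 *: (Z s * X true))
| gwa_rel_xmz s : gwa_rel p q X Z (X false * Z s - q *: (Z s * X false))
| gwa_rel_xpxm :
    gwa_rel p q X Z (X true * X false - horner_alg (Z true * Z false) p)
| gwa_rel_xmxp :
    gwa_rel p q X Z
      (X false * X true - horner_alg (q ^+ 2 *: (Z false * Z true)) p).

Definition gwa_quad (K : fieldType) (p : {poly K}) (q : K) (B : algType K)
    (X Z : bool -> B) : Prop := forall u, gwa_rel p q X Z u -> u = 0.

Lemma gwa_rel_lift (K : fieldType) (p : {poly K}) (q : K) (F B : algType K)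
    (f : {lrmorphism F -> B}) (X Z : bool -> F) (X' Z' : bool -> B) :
    (forall s, f (X s) = X' s) -> (forall s, f (Z s) = Z' s) ->
    gwa_quad p q X' Z' ->
  forall u, ideal_gen (gwa_rel p q X Z) u -> f u = 0.
Proof.
move=> fX fZ quad.
have fB x y : f (x - y) = f x - f y by exact: rmorphB.
have fM x y : f (x * y) = f x * f y by exact: rmorphM.
have fS k x : f (k *: x) = k *: f x by exact: linearZ.
move=> u; elim=> [|{}u rel|x y _ hx _ hy|a x b _ hx].
- exact: rmorph0.
- apply: quad; case: rel => [|s|s||];
    by rewrite fB ?fS !fM ?lrmorph_horner_alg ?fS ?fM ?fX ?fZ; constructor.
- by rewrite -[y]opprK fB; have:= fB 0 y; rewrite sub0r => ->; rewrite (rmorph0 f) hx hy !subr0.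
by rewrite !fM hx mulr0 mul0r.
Qed.

Section GWA.
Variables (K : fieldType) (p : {poly K}) (q : K).

(* (true, s) is the index of the generator x_s and (false, s) that of z_s,
   where s = true stands for the sign + and s = false for the sign -. *)
Notation F := (free_alg K (bool * bool)%type).
Let X (s : bool) : F := free_gen K (true, s).
Let Z (s : bool) : F := free_gen K (false, s).
Notation gwa_rel := (gwa_rel p q X Z).

Definition gwa_ideal : {pred F} := fun u => `[< ideal_gen gwa_rel u >].

Fact gwa_ideal_zmod_closed : zmod_closed gwa_ideal.
Proof.
split=> [|x y /asboolP Ix /asboolP Iy]; apply/asboolP; first exact: ideal_gen0.
apply: ideal_genD => //.
by rewrite -[y]mulr1 -[y]mul1r -!mulNr; apply: ideal_genM.
Qed.

HB.instance Definition _ :=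
  GRing.isZmodClosed.Build F gwa_ideal gwa_ideal_zmod_closed.

Definition gwa : Type := Quotient.quot gwa_ideal.

HB.instance Definition _ := GRing.Zmodule.on gwa.

Definition gwa_pi (u : F) : gwa := \pi_(Quotient.quot gwa_ideal) u.

Lemma gwa_piP u v : gwa_pi u = gwa_pi v <-> ideal_gen gwa_rel (u - v).
Proof.
rewrite /gwa_pi; split=> [/eqP|h]; last apply/eqP.
  by rewrite -Quotient.idealrBE => /asboolP.
by rewrite -Quotient.idealrBE; apply/asboolP.
Qed.

Definition gwa_repr (a : gwa) : F := repr (a : Quotient.quot gwa_ideal).

Lemma gwa_reprK : cancel gwa_repr gwa_pi.
Proof. by move=> a; rewrite /gwa_pi /gwa_repr reprK. Qed.

Lemma gwa_pi_surj a : exists u, a = gwa_pi u.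
Proof. by exists (gwa_repr a); rewrite gwa_reprK. Qed.

Fact gwa_piB : zmod_morphism gwa_pi.
Proof. by move=> x y; rewrite /gwa_pi raddfB. Qed.

HB.instance Definition _ := GRing.isZmodMorphism.Build F gwa gwa_pi gwa_piB.

Definition gwa_mul (a b : gwa) : gwa :=
  locked (fun u v : F => gwa_pi (u * v)) (gwa_repr a) (gwa_repr b).
Definition gwa_scale (k : K) (a : gwa) : gwa :=
  locked (fun u : F => gwa_pi (k *: u)) (gwa_repr a).

Fact gwa_mulE u v : gwa_mul (gwa_pi u) (gwa_pi v) = gwa_pi (u * v).
Proof.
rewrite /gwa_mul -lock; apply/gwa_piP; set u' := gwa_repr _; set v' := gwa_repr _.
have iu : ideal_gen gwa_rel (u' - u) by apply/gwa_piP; rewrite gwa_reprK.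
have iv : ideal_gen gwa_rel (v' - v) by apply/gwa_piP; rewrite gwa_reprK.
have -> : u' * v' - u * v = 1 * (u' - u) * v' + u * (v' - v) * 1.
  by rewrite mul1r mulr1 mulrBl mulrBr addrA addrNK.
by apply: ideal_genD; apply: ideal_genM.
Qed.

Fact gwa_scaleE k u : gwa_scale k (gwa_pi u) = gwa_pi (k *: u).
Proof.
rewrite /gwa_scale -lock; apply/gwa_piP; rewrite -scalerBr -mulr_algl -[_ * _]mulr1; apply: ideal_genM.
by apply/gwa_piP; rewrite gwa_reprK.
Qed.

Fact gwa_mulA : associative gwa_mul.
Proof.
move=> a b c; have [u ->] := gwa_pi_surj a; have [v ->] := gwa_pi_surj b.
by have [w ->] := gwa_pi_surj c; rewrite !gwa_mulE mulrA.
Qed.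

Fact gwa_mul1l : left_id (gwa_pi 1) gwa_mul.
Proof. by move=> a; have [u ->] := gwa_pi_surj a; rewrite gwa_mulE mul1r. Qed.

Fact gwa_mul1r : right_id (gwa_pi 1) gwa_mul.
Proof. by move=> a; have [u ->] := gwa_pi_surj a; rewrite gwa_mulE mulr1. Qed.

Fact gwa_mulDl : left_distributive gwa_mul +%R.
Proof.
move=> a b c; have [u ->] := gwa_pi_surj a; have [v ->] := gwa_pi_surj b.
by have [w ->] := gwa_pi_surj c; rewrite -raddfD !gwa_mulE mulrDl raddfD.
Qed.

Fact gwa_mulDr : right_distributive gwa_mul +%R.
Proof.
move=> a b c; have [u ->] := gwa_pi_surj a; have [v ->] := gwa_pi_surj b.
by have [w ->] := gwa_pi_surj c; rewrite -raddfD !gwa_mulE mulrDr raddfD.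
Qed.

(* A(p;q) is nonzero: x_+ |-> 1, x_- |-> p(0), z_+, z_- |-> 0 is a character. *)
Fact gwa_one_neq0 : gwa_pi 1 != 0.
Proof.
pose X' s : K^o := if s then 1 else p.[0].
pose Z' (s : bool) : K^o := 0.
have quad : gwa_quad p q X' Z'.
  have h (b : K^o) : horner_alg b p = p.[b].
    rewrite -[in LHS](coefK p) poly_def linear_sum horner_coef /=.
    apply: eq_bigr => i _.
    by rewrite linearZ rmorphXn /= horner_algX; apply: mulr_algl.
  move=> u [|s|s||].
  - by rewrite /Z' subrr.
  - by rewrite /Z' mulr0 mul0r scaler0 subrr.
  - by rewrite /Z' mulr0 mul0r scaler0 subrr.
  - by rewrite h /Z' /X' mul1r mulr0 subrr.
  - by rewrite h /Z' /X' mulr1 mulr0 scaler0 subrr.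
pose v (g : bool * bool) : K^o := if g.1 then X' g.2 else Z' g.2.
apply/eqP; rewrite -(raddf0 gwa_pi) => /gwa_piP.
rewrite subr0 => /(gwa_rel_lift (f := free_lift v) _ _ quad) h.
have /eqP : free_lift v 1 = 0 by apply: h => s; apply: free_lift_gen.
by rewrite rmorph1 oner_eq0.
Qed.

HB.instance Definition _ := GRing.Zmodule_isNzRing.Build gwa
  gwa_mulA gwa_mul1l gwa_mul1r gwa_mulDl gwa_mulDr gwa_one_neq0.

Fact gwa_pi_monoid : monoid_morphism gwa_pi.
Proof. by split=> // u v; apply: esym (gwa_mulE u v). Qed.

HB.instance Definition _ :=
  GRing.isMonoidMorphism.Build F gwa gwa_pi gwa_pi_monoid.

Fact gwa_scaleA a b x : gwa_scale a (gwa_scale b x) = gwa_scale (a * b) x.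
Proof. by have [u ->] := gwa_pi_surj x; rewrite !gwa_scaleE scalerA. Qed.

Fact gwa_scale1 : left_id 1 gwa_scale.
Proof.
by move=> x; have [u ->] := gwa_pi_surj x; rewrite gwa_scaleE scale1r.
Qed.

Fact gwa_scaleDr : right_distributive gwa_scale +%R.
Proof.
move=> a x y; have [u ->] := gwa_pi_surj x; have [v ->] := gwa_pi_surj y.
by rewrite -raddfD !gwa_scaleE scalerDr raddfD.
Qed.

Fact gwa_scaleDl x : {morph gwa_scale^~ x : a b / a + b}.
Proof.
move=> a b; have [u ->] := gwa_pi_surj x.
by rewrite !gwa_scaleE scalerDl raddfD.
Qed.

HB.instance Definition _ := GRing.Zmodule_isLmodule.Build K gwa
  gwa_scaleA gwa_scale1 gwa_scaleDr gwa_scaleDl.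

Fact gwa_piZ : scalable gwa_pi.
Proof. by move=> k u; apply: esym (gwa_scaleE k u). Qed.

HB.instance Definition _ := GRing.isScalable.Build K F gwa *:%R gwa_pi gwa_piZ.

Fact gwa_scaleAl (k : K) (a b : gwa) : k *: (a * b) = (k *: a) * b.
Proof.
have [u ->] := gwa_pi_surj a; have [v ->] := gwa_pi_surj b.
by rewrite -rmorphM -!linearZ -rmorphM scalerAl.
Qed.

HB.instance Definition _ := GRing.Lmodule_isLalgebra.Build K gwa gwa_scaleAl.

Fact gwa_scaleAr (k : K) (a b : gwa) : k *: (a * b) = a * (k *: b).
Proof.
have [u ->] := gwa_pi_surj a; have [v ->] := gwa_pi_surj b.
by rewrite -rmorphM -!linearZ -rmorphM scalerAr.
Qed.

HB.instance Definition _ := GRing.Lalgebra_isAlgebra.Build K gwa gwa_scaleAr.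

Definition gwa_x (s : bool) : gwa := locked (gwa_pi (X s)).
Definition gwa_z (s : bool) : gwa := locked (gwa_pi (Z s)).

Lemma gwa_quad_gen : gwa_quad p q gwa_x gwa_z.
Proof.
have pi0 w : gwa_rel w -> gwa_pi w = 0.
  move=> hw; rewrite -(raddf0 gwa_pi); apply/gwa_piP.
  by rewrite subr0; apply: ideal_gen_rel.
have xE s : gwa_x s = gwa_pi (X s) by rewrite /gwa_x -lock.
have zE s : gwa_z s = gwa_pi (Z s) by rewrite /gwa_z -lock.
have piB a b : gwa_pi (a - b) = gwa_pi a - gwa_pi b by exact: rmorphB.
have piM a b : gwa_pi (a * b) = gwa_pi a * gwa_pi b by exact: rmorphM.
have piS k a : gwa_pi (k *: a) = k *: gwa_pi a by exact: linearZ.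
have piH a : gwa_pi (horner_alg a p) = horner_alg (gwa_pi a) p.
  exact: (lrmorph_horner_alg gwa_pi).
move=> _ [|s|s||]; rewrite ?xE ?zE.
- by rewrite -2!piM -piB; apply/pi0/gwa_rel_zz.
- by rewrite -2!piM -piS -piB; apply/pi0/gwa_rel_xpz.
- by rewrite -2!piM -piS -piB; apply/pi0/gwa_rel_xmz.
- by rewrite -2!piM -piH -piB; apply/pi0/gwa_rel_xpxm.
by rewrite -2!piM -piS -piH -piB; apply/pi0/gwa_rel_xmxp.
Qed.

Section Lift.
Variables (B : algType K) (X' Z' : bool -> B) (quad : gwa_quad p q X' Z').

Let v (g : bool * bool) : B := if g.1 then X' g.2 else Z' g.2.

Definition gwa_lift (a : gwa) : B := free_lift v (gwa_repr a).

Fact gwa_liftE u : gwa_lift (gwa_pi u) = free_lift v u.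
Proof.
apply/eqP; rewrite -subr_eq0 -rmorphB; apply/eqP.
apply: (gwa_rel_lift (f := free_lift v) _ _ quad); last first.
  by apply/gwa_piP; rewrite gwa_reprK.
all: by move=> s; apply: free_lift_gen.
Qed.

Fact gwa_liftB : zmod_morphism gwa_lift.
Proof.
move=> a b; have [x ->] := gwa_pi_surj a; have [y ->] := gwa_pi_surj b.
by rewrite -rmorphB !gwa_liftE rmorphB.
Qed.

Fact gwa_liftM : monoid_morphism gwa_lift.
Proof.
split=> [|a b]; first by rewrite -[1]/(gwa_pi 1) gwa_liftE rmorph1.
have [x ->] := gwa_pi_surj a; have [y ->] := gwa_pi_surj b.
by rewrite -rmorphM !gwa_liftE rmorphM.
Qed.

Fact gwa_liftZ : scalable gwa_lift.
Proof.
move=> k a; have [x ->] := gwa_pi_surj a.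
by rewrite -linearZ !gwa_liftE linearZ.
Qed.

HB.instance Definition _ := GRing.isZmodMorphism.Build gwa B gwa_lift gwa_liftB.
HB.instance Definition _ := GRing.isMonoidMorphism.Build gwa B gwa_lift gwa_liftM.
HB.instance Definition _ :=
  GRing.isScalable.Build K gwa B *:%R gwa_lift gwa_liftZ.

Lemma gwa_lift_x s : gwa_lift (gwa_x s) = X' s.
Proof. by rewrite /gwa_x -lock gwa_liftE; apply: free_lift_gen. Qed.

Lemma gwa_lift_z s : gwa_lift (gwa_z s) = Z' s.
Proof. by rewrite /gwa_z -lock gwa_liftE; apply: free_lift_gen. Qed.

End Lift.

End GWA.

Section GWATheory.
Variables (K : fieldType) (p : {poly K}) (q : K).
Notation A := (gwa p q).

Definition gwa_zz : A := gwa_z p q true * gwa_z p q false.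

(* [gwa_homog d a] : a belongs to the component of degree d, for the grading
   with |x_+| = |z_+| = 1 and |x_-| = |z_-| = -1. *)
Inductive gwa_homog : int -> A -> Prop :=
| gwa_homog1 : gwa_homog 0 1
| gwa_homog_x s : gwa_homog (if s then 1 else -1) (gwa_x p q s)
| gwa_homog_z s : gwa_homog (if s then 1 else -1) (gwa_z p q s)
| gwa_homogM d e a b of gwa_homog d a & gwa_homog e b :
    gwa_homog (d + e) (a * b)
| gwa_homogZD d k a b of gwa_homog d a & gwa_homog d b :
    gwa_homog d (k *: a + b).

(* The monomials x_-^r z_+^m z_-^l (for e = Negz r.-1, r > 0) and
   x_+^r z_+^m z_-^l (for e = Posz r), each listed once. *)
Definition gwa_mono (u : int * nat * nat) : A :=
  let: (e, m, l) := u in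
  (if e is Posz r then gwa_x p q true ^+ r else gwa_x p q false ^+ `|e|%N)
    * gwa_z p q true ^+ m * gwa_z p q false ^+ l.

Definition gwa_in_Kz (a : A) : Prop := exists f : {poly K}, a = horner_alg gwa_zz f.

End GWATheory.

(* The indices -, 0, + label the three coordinates in this order. *)
Definition idxm : 'I_3 := @Ordinal 3 0 isT.
Definition idx0 : 'I_3 := @Ordinal 3 1 isT.
Definition idxp : 'I_3 := @Ordinal 3 2 isT.

Section Calculus.
Variables (K : fieldType) (A : algType K).
Variables (sigma : 'I_3 -> {lrmorphism A -> A}) (partial : 'I_3 -> {linear A -> A}).

(* Omega is the free left A-module of row vectors; its right action is
   (\sum_i a_i *: omega i) . b = \sum_i a_i * sigma i b *: omega i. *)
Definition omega (i : 'I_3) : 'rV[A]_3 := delta_mx 0 i.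

Definition omega_ract (w : 'rV[A]_3) (b : A) : 'rV[A]_3 :=
  \row_i (w 0 i * sigma i b).

Definition omega_d (a : A) : 'rV[A]_3 := \sum_i partial i a *: omega i.

Definition right_linear (f : 'rV[A]_3 -> A) : Prop :=
  (forall w1 w2, f (w1 + w2) = f w1 + f w2)
  /\ (forall w b, f (omega_ract w b) = f w * b).

Record rhom := RHom { rhom_fun :> 'rV[A]_3 -> A ; rhomP : right_linear rhom_fun }.

Lemma rhom_ext (f g : rhom) : f =1 g -> f = g.
Proof.
case: f g => [f Hf] [g Hg] /= /funext fg; move: Hf; rewrite fg => Hf.
by rewrite (Prop_irrelevance Hf Hg).
Qed.

HB.instance Definition _ := gen_eqMixin rhom.
HB.instance Definition _ := gen_choiceMixin rhom.

Fact rhom_zeroP : right_linear (fun=> 0).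
Proof. by split=> *; rewrite ?addr0 ?mul0r. Qed.
Fact rhom_oppP (f : rhom) : right_linear (fun w => - f w).
Proof.
by have [fD fM] := rhomP f; split=> *; rewrite ?fD ?fM ?opprD ?mulNr.
Qed.
Fact rhom_addP (f g : rhom) : right_linear (fun w => f w + g w).
Proof.
have [fD fM] := rhomP f; have [gD gM] := rhomP g.
by split=> *; rewrite ?fD ?gD ?fM ?gM ?mulrDl // addrACA.
Qed.
Fact rhom_scaleP (k : K) (f : rhom) : right_linear (fun w => k *: f w).
Proof.
by have [fD fM] := rhomP f; split=> *; rewrite ?fD ?fM ?scalerDr ?scalerAl.
Qed.

Definition rhom_zero : rhom := RHom rhom_zeroP.
Definition rhom_opp f : rhom := RHom (rhom_oppP f).
Definition rhom_add f g : rhom := RHom (rhom_addP f g).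
Definition rhom_scale k f : rhom := RHom (rhom_scaleP k f).

Fact rhom_addA : associative rhom_add.
Proof. by move=> f g h; apply: rhom_ext => w /=; rewrite addrA. Qed.
Fact rhom_addC : commutative rhom_add.
Proof. by move=> f g; apply: rhom_ext => w /=; rewrite addrC. Qed.
Fact rhom_add0 : left_id rhom_zero rhom_add.
Proof. by move=> f; apply: rhom_ext => w /=; rewrite add0r. Qed.
Fact rhom_addN : left_inverse rhom_zero rhom_opp rhom_add.
Proof. by move=> f; apply: rhom_ext => w /=; rewrite addNr. Qed.

HB.instance Definition _ :=
  GRing.isZmodule.Build rhom rhom_addA rhom_addC rhom_add0 rhom_addN.

Fact rhom_scaleA a b f : rhom_scale a (rhom_scale b f) = rhom_scale (a * b) f.
Proof. by apply: rhom_ext => w /=; rewrite scalerA. Qed.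
Fact rhom_scale1 : left_id 1 rhom_scale.
Proof. by move=> f; apply: rhom_ext => w /=; rewrite scale1r. Qed.
Fact rhom_scaleDr : right_distributive rhom_scale +%R.
Proof. by move=> a f g; apply: rhom_ext => w /=; rewrite scalerDr. Qed.
Fact rhom_scaleDl f : {morph rhom_scale^~ f : a b / a + b}.
Proof. by move=> a b; apply: rhom_ext => w /=; rewrite scalerDl. Qed.

HB.instance Definition _ := GRing.Zmodule_isLmodule.Build K rhom
  rhom_scaleA rhom_scale1 rhom_scaleDr rhom_scaleDl.

Fact rhom_actP (a : A) (f : rhom) (b : A) :
  right_linear (fun w => a * f (b *: w)).
Proof.
have [fD fM] := rhomP f; split=> [w1 w2|w c].
  by rewrite scalerDr fD mulrDr.
rewrite -mulrA -fM; congr (a * f _).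
by apply/rowP=> i; rewrite !mxE mulrA.
Qed.

Definition rhom_act a f b : rhom := RHom (rhom_actP a f b).

Definition is_divergence (D : {linear rhom -> A}) : Prop :=
  forall (a : A) (f : rhom), D (rhom_act 1 f a) = D f * a + f (omega_d a).

Definition dual_basis (xi : 'I_3 -> rhom) : Prop :=
  forall i j, xi i (omega j) = (i == j)%:R.

Section Div.
Variable q : K.

Definition gwa_div (f : rhom) : A :=
  q ^- 2 *: partial idxm (f (omega idxm)) + partial idx0 (f (omega idx0))
  + q ^+ 2 *: partial idxp (f (omega idxp)).

Fact gwa_div_linear : linear gwa_div.
Proof.
move=> k f g; rewrite /gwa_div /= !linearP !scalerDr !scalerA ![k * _]mulrC.
by rewrite [RHS]addrACA [X in _ = X + _]addrACA.
Qed.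

HB.instance Definition _ := GRing.isLinear.Build K rhom A *:%R gwa_div gwa_div_linear.
End Div.
End Calculus.

Section GWACalculus.
Variables (K : fieldType) (p : {poly K}) (q : K) (alpha : 'I_3 -> K).
Notation A := (gwa p q).
Notation xp := (gwa_x p q true).
Notation xm := (gwa_x p q false).
Notation zp := (gwa_z p q true).
Notation zm := (gwa_z p q false).
Notation c := (horner_alg (gwa_zz p q) (q *: q2_deriv p q)).

Definition gwa_twists (sigma : 'I_3 -> {lrmorphism A -> A}) : Prop :=
  forall d a, gwa_homog d a ->
    [/\ sigma idxm a = q ^ d *: a, sigma idx0 a = q ^ (2 * d) *: a
      & sigma idxp a = q ^ d *: a].

Definition skew_derivation (B : algType K) (s : {lrmorphism B -> B})
    (D : {linear B -> B}) : Prop :=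
  forall a b, D (a * b) = D a * s b + a * D b.

Definition gwa_derivations (sigma : 'I_3 -> {lrmorphism A -> A})
    (partial : 'I_3 -> {linear A -> A}) : Prop :=
  [/\ forall i, skew_derivation (sigma i) (partial i),
      [/\ partial idx0 xp = alpha idx0 *: xp,
          partial idx0 xm = - q ^- 2 * alpha idx0 *: xm,
          partial idx0 zp = alpha idx0 *: zp
        & partial idx0 zm = - q ^- 2 * alpha idx0 *: zm],
      [/\ partial idxm xp = 0,
          partial idxm zp = 0,
          partial idxm xm = alpha idxm *: (c * zp)
        & partial idxm zm = alpha idxm *: xp]
    & [/\ partial idxp xm = 0,
          partial idxp zm = 0,
          partial idxp xp = alpha idxp *: (c * zm)
        & partial idxp zp = alpha idxp *: xm]].

End GWACalculus.

(* Main.v *)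
Require Import Defs.
From HB Require Import structures.
From mathcomp Require Import all_boot all_order all_algebra.
From mathcomp Require Import boolp functions ring zify finmap monalg.

(** Moving omega_i past an element of A applies the automorphism sigma_i, so
    the omega_i are also a basis of Omega as a right module, and an element xi
    of the dual is an arbitrary triple of values xi(omega_i).  This gives the
    first part: every xi is the sum of the xi_i . sigma_i(xi(omega_i)), so the
    Leibniz rule determines a divergence from its values on the dual basis
    ([divergence_unique]), and [gwa_div] obeys that rule because sigma_i^-1
    commutes with partial_i up to the weight q^2, 1 or q^-2
    ([div_divergence]).  It also shows that the image of div is
    Im partial_- + Im partial_0 + Im partial_+, so that Lambda is the
    quotient by these three images ([Lambda_partial]).

    The three images are computed on monomials.  First,
    partial_0 = alpha_0 (sigma_0 - id) / (q^2 - 1), whose image is spanned by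
    the monomials of nonzero degree.  Next, up to a nonzero scalar, partial_-
    sends x_+^r z_+^m z_-^(l+1) to x_+^(r+1) z_+^m z_-^l, and partial_+ does
    the same with the signs exchanged, so Lambda kills every monomial that
    contains some x.  What is left is K[z], and the decisive computation
    ([partial_Kz]) is that partial_-(x_- z_+^m z_-^(m+1)) is a nonzero
    multiple of Q(p X^m) evaluated at z, where
      Q(g) = q^2 g(q^2 X) - g        ([qeuler]);
    this is where the value q p_(q^2)(z) z_+ of partial_- at x_- enters.  Hence
    Lambda vanishes on Q(p f)(z), which is the second part.

    Q is diagonal: Q(X^j) = (q^(2(j+1)) - 1) X^j, with nonzero eigenvalues
    since q is not a root of unity.  So L(g) = Lambda(Q(g)(z)) is a linear map
    that kills the ideal (p), and v_j = Lambda(z^j) is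
    L(X^j) / (q^(2(j+1)) - 1): the v_j with j < n span, and reducing X^(n+k)
    modulo p gives the recurrence, in which [j+1] appears as the eigenvalue
    divided by q^2 - 1.

    For the independence of v_0, ..., v_(n-1) the images have to be bounded
    from above.  The algebra acts on functions on Z x Z with values in
    K[X]; this representation separates the monomials (hence they form a
    basis) and defines a projection of A onto K[z].  The algebra is in fact
    bigraded, by the degrees in the x's and in the z's, and partial_- and
    partial_+ are homogeneous of bidegree (1,1) and (-1,-1).  So the only
    monomials whose image meets K[z] are those of the computation above, and
    the projection maps Im div into Q((p)) ([proj_div]).  A polynomial of degree
    less than n in Q((p)) is 0 because Q preserves degrees
    ([qeuler_multiple_small]). *)

Set Implicit Arguments.
Unset Strict Implicit.
Unset Printing Implicit Defensive.

Import GRing.Theory.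
Local Open Scope ring_scope.

(** * Linear spans *)

Section Span.
Variables (K : fieldType) (V : lmodType K) (I : eqType) (e : I -> V).

Definition spanned (v : V) : Prop :=
  exists2 s : seq I, uniq s & exists c : I -> K, v = \sum_(i <- s) c i *: e i.

Lemma spanned_cons k i v : spanned v -> spanned (k *: e i + v).
Proof.
case=> s us [c ->]; have [si|si] := boolP (i \in s).
  exists s => //; exists [eta c with i |-> k + c i].
  rewrite !(bigD1_seq i) //= eqxx scalerDl addrA; congr (_ + _).
  by apply: eq_bigr => j /negPf ->.
exists (i :: s); first by rewrite /= si.
exists [eta c with i |-> k]; rewrite big_cons /= eqxx; congr (_ + _).
rewrite !big_seq; apply: eq_bigr => j sj.
by case: eqP => // ij; rewrite -ij sj in si.
Qed.

Lemma spanned0 : spanned 0.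
Proof. by exists [::] => //; exists (fun=> 0); rewrite big_nil. Qed.

Lemma spanned_gen i : spanned (e i).
Proof. by have:= spanned_cons 1 i spanned0; rewrite scale1r addr0. Qed.

Lemma spannedD u v : spanned u -> spanned v -> spanned (u + v).
Proof.
move=> [s _ [c ->]] sv; elim: s => [|i s IHs]; first by rewrite big_nil add0r.
by rewrite big_cons -addrA; apply: spanned_cons.
Qed.

Lemma spannedZ k v : spanned v -> spanned (k *: v).
Proof.
move=> [s us [c ->]]; exists s => //; exists (fun i => k * c i).
by rewrite scaler_sumr; apply: eq_bigr => i _; rewrite scalerA.
Qed.

Lemma spanned_sum J (r : seq J) (F : J -> V) :
  (forall j, spanned (F j)) -> spanned (\sum_(j <- r) F j).
Proof.
by move=> sF; elim/big_rec: _ => [|j v _]; [exact: spanned0 | exact: spannedD].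
Qed.

End Span.

Lemma spanned_linear (K : fieldType) (V W : lmodType K) (I J : eqType)
    (e : I -> V) (e' : J -> W) (f : {linear V -> W}) :
  (forall i, spanned e' (f (e i))) -> forall v, spanned e v -> spanned e' (f v).
Proof.
move=> fe v [s _ [c ->]]; rewrite linear_sum.
by apply: spanned_sum => i; rewrite linearZ; apply: spannedZ.
Qed.

Lemma linear_ext_span (K : fieldType) (V W : lmodType K) (I : eqType)
    (e : I -> V) (f g : {linear V -> W}) :
  (forall i, f (e i) = g (e i)) -> forall v, spanned e v -> f v = g v.
Proof.
move=> fg v [s _ [c ->]]; rewrite !linear_sum.
by apply: eq_bigr => i _; rewrite !linearZ /= fg.
Qed.

(** * Skew derivations of an algebra *)

Lemma scaler_mul (K : fieldType) (B : algType K) (a b : K) (y y' : B) :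
  (a *: y) * (b *: y') = (a * b) *: (y * y').
Proof. by rewrite -scalerAl -scalerAr scalerA. Qed.

Lemma scaler_mul3 (K : fieldType) (B : algType K) (a b c : K) (y y' y'' : B) :
  (a *: y) * ((b *: y') * (c *: y'')) = (a * (b * c)) *: (y * (y' * y'')).
Proof. by rewrite !scaler_mul. Qed.

Lemma scaler_balance (K : fieldType) (V : lmodType K) (a b c d : K) (v : V) :
  a * b = c * (d * a) -> a *: (b *: v) = c *: (d *: (a *: v)).
Proof. by rewrite !scalerA mulrA => ->. Qed.

Lemma scaler_balance_mul (K : fieldType) (B : algType K) (a b c d : K) (u v : B) :
  a * b = c * (d * a) -> a *: (u * (b *: v)) = c *: (d *: (a *: (u * v))).
Proof. by move=> h; rewrite -scalerAr; apply: scaler_balance. Qed.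

Lemma scaler_sub1 (K : fieldType) (V : lmodType K) (c k : K) (v : V) :
  c *: (k *: v - v) = (c * (k - 1)) *: v.
Proof. by rewrite -{2}[v]scale1r -scalerBl scalerA. Qed.

Lemma scaler_sub_comb (K : fieldType) (V : lmodType K) (c k : K) (u v a b : V) :
  k *: (c *: (u - a)) + c *: (v - b) = c *: (k *: u + v - (k *: a + b)).
Proof.
by rewrite [k *: (_ *: _)]scalerA [k * c]mulrC -scalerA -scalerDr scalerBr opprD addrACA.
Qed.

Lemma horner_algZ (K : fieldType) (B : algType K) (b : B) (k : K) g :
  horner_alg b (k *: g) = k *: horner_alg b g.
Proof. by rewrite linearZ /= mulr_algl. Qed.

Lemma qcommX (K : fieldType) (B : algType K) (k : K) (y a : B) n :
  y * a = k *: (a * y) -> y * a ^+ n = k ^+ n *: (a ^+ n * y).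
Proof.
move=> ya; elim: n => [|n IHn]; first by rewrite !expr0 mulr1 mul1r scale1r.
rewrite [a ^+ _]exprSr [LHS]mulrA IHn -scalerAl -[_ * y * a]mulrA ya.
by rewrite -scalerAr scalerA -[k ^+ n * k]exprSr mulrA.
Qed.

Lemma qcommZ (K : fieldType) (B : algType K) (a b k : K) (y y' : B) :
  y * y' = k *: (y' * y) -> (a *: y) * (b *: y') = k *: ((b *: y') * (a *: y)).
Proof. by move=> yy'; rewrite !scaler_mul yy' !scalerA mulrC [a * b]mulrC. Qed.

(** The scaling attached to the degree, which is 1 for the generators of sign +
    and -1 for those of sign -. *)
Definition spow (K : fieldType) (la : K) (s : bool) : K := if s then la else la^-1.

Lemma spow_neq0 (K : fieldType) (la : K) s : la != 0 -> spow la s != 0.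
Proof. by case: s => //=; rewrite invr_eq0. Qed.

Lemma spowN (K : fieldType) (k : K) t : spow k (~~ t) = (spow k t)^-1.
Proof. by case: t; rewrite /= ?invrK. Qed.

Lemma spowM (K : fieldType) (a b : K) t : spow (a * b) t = spow a t * spow b t.
Proof. by case: t; rewrite //= invfM. Qed.

Lemma spowVK (K : fieldType) (k : K) s : k != 0 -> spow k^-1 s * spow k s = 1.
Proof. by case: s => k0 /=; rewrite ?invrK ?mulVf ?mulfV. Qed.

Lemma spow_exp_neq1 (K : fieldType) (q : K) :
  (forall k : nat, (0 < k)%N -> q ^+ k != 1) ->
  forall t k, (0 < k)%N -> spow q t ^+ k != 1.
Proof. by move=> qn [] k k0; rewrite /= ?exprVn ?invr_eq1 qn. Qed.

Lemma spow_mul (K : fieldType) (B : algType K) (la : K) s (y y' : B) :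
  la != 0 -> (spow la s *: y) * (spow la (~~ s) *: y') = y * y'.
Proof.
by move=> la0; rewrite scaler_mul; case: s; rewrite /= ?mulfV ?mulVf // scale1r.
Qed.

Lemma same_or_opp (s t : bool) : s = t \/ s = ~~ t.
Proof. by case: s; case: t; [left | right | right | left]. Qed.

Lemma skew_one (K : fieldType) (A : algType K) (s : {lrmorphism A -> A})
    (D : {linear A -> A}) : skew_derivation s D -> D 1 = 0.
Proof.
move=> DM; apply: (addrI (D 1)); rewrite addr0.
by rewrite -[in RHS](mulr1 1) DM rmorph1 mulr1 mul1r.
Qed.

Lemma skew_commM (K : fieldType) (A : algType K) (s phi : {lrmorphism A -> A})
    (D : {linear A -> A}) (w : K) (a b : A) :
    skew_derivation s D -> (forall a, phi (s a) = s (phi a)) ->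
    phi (D a) = w *: D (phi a) -> phi (D b) = w *: D (phi b) ->
  phi (D (a * b)) = w *: D (phi (a * b)).
Proof.
move=> DM phis wa wb; rewrite DM rmorphD !rmorphM /= DM phis wa wb.
by rewrite scalerDr -scalerAl -scalerAr.
Qed.

(** The symmetric q-number arises because [s] scales [a] by k^-1 while moving
    [b] past [a] costs k: the n + 1 terms of the Leibniz expansion carry the
    powers k^n, k^(n-2), ..., k^-n. *)
Lemma skew_exp (K : fieldType) (A : algType K)
    (s : {lrmorphism A -> A}) (D : {linear A -> A}) (k : K) (a b : A) n :
    skew_derivation s D -> k != 0 -> k ^+ 2 != 1 ->
    s a = k^-1 *: a -> D a = b -> a * b = k *: (b * a) ->
  D (a ^+ n.+1) = ((k ^+ n.+1 - k ^- n.+1) / (k - k^-1)) *: (b * a ^+ n).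
Proof.
move=> DM k0 k2 sa Da ab.
have kk : k - k^-1 != 0.
  apply: contra k2; rewrite subr_eq0 => /eqP kE.
  by rewrite expr2 {1}kE mulVf.
elim: n => [|n IHn]; first by rewrite !expr1 expr0 mulr1 mulfV // scale1r.
have abn : a ^+ n.+1 * b = k ^+ n.+1 *: (b * a ^+ n.+1).
  elim: n.+1 => [|i IHi]; first by rewrite !expr0 mulr1 mul1r scale1r.
  rewrite exprS -[LHS]mulrA IHi -scalerAr [a * (b * _)]mulrA ab -scalerAl scalerA.
  by rewrite -mulrA -!exprS -exprSr.
rewrite exprSr DM IHn Da sa abn -scalerAr -scalerAl -mulrA -exprSr !scalerA -scalerDl.
congr (_ *: _); rewrite !exprS; field.
by rewrite k0 expf_neq0 // andbT subr_eq0.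
Qed.

(** partial_- and partial_+ are treated at once: the suffix t marks the
    generators of the sign that the derivation kills, the suffix n those of the
    opposite sign.  The constant [k] is q for partial_- and q^-1 for
    partial_+. *)
Section SkewDerivation.
Variables (K : fieldType) (B : algType K).
Variables (s : {lrmorphism B -> B}) (D : {linear B -> B}).
Hypothesis DM : skew_derivation s D.

Lemma skew_ker_exp a b n : D a = 0 -> D (a ^+ n * b) = a ^+ n * D b.
Proof.
move=> Da; elim: n b => [|n IHn] b; first by rewrite !expr0 !mul1r.
by rewrite exprSr -mulrA IHn DM Da mul0r add0r mulrA.
Qed.

Variables (k al : K) (xt xn zt zn : B) (c P : {poly K}).
Hypotheses (k_neq0 : k != 0) (k2 : k ^+ 2 != 1).
Hypotheses (ztxt : zt * xt = k *: (xt * zt)) (znxt : zn * xt = k *: (xt * zn)).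
Hypotheses (zC : zt * zn = zn * zt).
Hypotheses (szt : s zt = k *: zt) (szn : s zn = k^-1 *: zn).
Hypotheses (Dxt : D xt = 0) (Dzt : D zt = 0) (Dzn : D zn = al *: xt).

Definition sym_bracket (n : nat) : K := (k ^+ n - k ^- n) / (k - k^-1).

(** One factor zn is traded for one xt.  Since [r], [m] and [l] are
    arbitrary, every monomial with an xt is in the image of [D]. *)
Lemma skew_mono r m l :
  D (xt ^+ r * (zt ^+ m * zn ^+ l.+1))
  = (al * k ^+ m * sym_bracket l.+1) *: (xt ^+ r.+1 * (zt ^+ m * zn ^+ l)).
Proof.
rewrite skew_ker_exp // skew_ker_exp //.
rewrite (skew_exp l DM k_neq0 k2 szn Dzn); last first.
  by rewrite -scalerAr znxt -scalerAl !scalerA mulrC.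
have ztx : zt ^+ m * xt = k ^+ m *: (xt * zt ^+ m).
  elim: m => [|m IHm]; first by rewrite !expr0 mul1r mulr1 scale1r.
  rewrite [zt ^+ _]exprS -mulrA IHm -scalerAr [zt * (xt * _)]mulrA ztxt.
  by rewrite -scalerAl scalerA -mulrA -[k ^+ m * k]exprSr.
rewrite -!scalerAl -!scalerAr !scalerA -/(sym_bracket l.+1).
rewrite [zt ^+ m * (xt * _)]mulrA ztx -scalerAl -scalerAr scalerA exprSr -!mulrA.
by congr (_ *: _); rewrite /sym_bracket; ring.
Qed.

Hypotheses (xnxt : xn * xt = horner_alg (zt * zn) P).
Hypotheses (Dxn : D xn = al *: (horner_alg (zt * zn) c * zt)).

(** Of the two terms of the Leibniz rule, the first comes from [D xn], and the
    second from trading zn for xt, after which xn meets xt and gives [P]. *)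
Lemma skew_Kz m :
  D (xn * (zt ^+ m * zn ^+ m.+1)) =
  horner_alg (zt * zn)
    (al *: (k^-1 *: (c * 'X^(m.+1)) + (k ^+ m * sym_bracket m.+1) *: (P * 'X^m))).
Proof.
have gwa_zzX j : zt ^+ j * zn ^+ j = horner_alg (zt * zn) 'X^j.
  by rewrite rmorphXn /= horner_algX exprMn_comm.
have sa : s (zt ^+ m * zn ^+ m.+1) = k^-1 *: (zt ^+ m * zn ^+ m.+1).
  rewrite rmorphM !rmorphXn /= szt szn !exprZn scaler_mul; congr (_ *: _).
  by rewrite exprVn exprS; field; rewrite k_neq0 expf_neq0.
have := skew_mono 0 m m; rewrite expr0 mul1r expr1 => Da.
rewrite DM sa Da Dxn -!scalerAr -scalerAl.
rewrite [_ * zt * _]mulrA -[_ * zt * _]mulrA -exprS -mulrA.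
rewrite gwa_zzX [xn * _]mulrA xnxt gwa_zzX !linearZ linearD !linearZ /= !rmorphM /=.
by rewrite !mulr_algl scalerDr !scalerA [al * (_ * _)]mulrA.
Qed.

End SkewDerivation.

(** * Dilations of polynomials and the operator Q *)

Section Dilation.
Variable K : fieldType.

Definition dilate (k : K) (g : {poly K}) : {poly K} := g \Po (k *: 'X).

Fact dilate_linear k : linear (dilate k).
Proof. exact: linearP. Qed.

HB.instance Definition _ (k : K) :=
  GRing.isLinear.Build K {poly K} {poly K} *:%R (dilate k) (dilate_linear k).

Lemma dilateM k g h : dilate k (g * h) = dilate k g * dilate k h.
Proof. exact: comp_polyM. Qed.

Lemma dilate1 g : dilate 1 g = g.
Proof. by rewrite /dilate scale1r comp_polyXr. Qed.

Lemma dilateXn k n : dilate k 'X^n = k ^+ n *: 'X^n.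
Proof. by rewrite /dilate comp_Xn_poly exprZn. Qed.

Lemma coef_dilate k g i : (dilate k g)`_i = k ^+ i * g`_i.
Proof.
rewrite /dilate comp_polyE coef_sum.
under eq_bigr => j _ do rewrite exprZn scalerA coefZ coefXn.
have [ig|gi] := ltnP i (size g).
  rewrite (bigD1 (Ordinal ig)) //= eqxx mulr1 big1 ?addr0 1?mulrC // => j.
  by rewrite -val_eqE /= eq_sym => /negPf ->; rewrite mulr0.
rewrite nth_default // mulr0 big1 // => j _.
by rewrite gtn_eqF ?mulr0 // (leq_trans _ gi).
Qed.

Lemma dilate_neq0 k g : k != 0 -> g != 0 -> dilate k g != 0.
Proof.
move=> k0 g0; rewrite -lead_coef_eq0 in g0; apply/eqP.
move=> /(congr1 (fun h : {poly K} => h`_(size g).-1))/eqP.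
by rewrite coef0 coef_dilate mulf_eq0 expf_eq0 (negPf k0) andbF (negPf g0).
Qed.

End Dilation.

Lemma horner_alg_dilate (K : fieldType) (B : algType K) (b : B) k g :
  horner_alg b (dilate k g) = horner_alg (k *: b) g.
Proof.
elim/poly_ind: g => [|g c IHg]; first by rewrite linear0 !rmorph0.
rewrite linearD /= dilateM [dilate k 'X](dilateXn k 1) expr1.
rewrite [dilate k c%:P]comp_polyC !rmorphD !rmorphM /= IHg linearZ /=.
by rewrite !horner_algX !horner_algC mulr_algl.
Qed.

Section QEuler.
Variables (K : fieldType) (q : K).

(** Up to the factor q^2 - 1 this is the q^2-derivative of X g. *)
Definition qeuler (g : {poly K}) : {poly K} := q ^+ 2 *: dilate (q ^+ 2) g - g.

Fact qeuler_linear : linear qeuler.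
Proof.
move=> k g h; rewrite /qeuler linearP /= scalerDr opprD addrACA scalerBr.
by rewrite !scalerA mulrC.
Qed.

HB.instance Definition _ :=
  GRing.isLinear.Build K {poly K} {poly K} *:%R qeuler qeuler_linear.

Lemma coef_qeuler g j : (qeuler g)`_j = (q ^+ (2 * j.+1) - 1) * g`_j.
Proof.
rewrite /qeuler coefB coefZ coef_dilate mulrA -exprM -exprD mulrBl mul1r.
by congr (q ^+ _ * _ - _); rewrite mulnS.
Qed.

Lemma qeulerXn j : qeuler 'X^j = (q ^+ (2 * j.+1) - 1) *: 'X^j.
Proof.
apply/polyP => i; rewrite coef_qeuler coefZ coefXn.
by case: eqP => [->|]; rewrite // !mulr0.
Qed.

Hypothesis q_neq0 : q != 0.
Hypothesis q_nroot : forall k : nat, (0 < k)%N -> q ^+ k != 1.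
Variable p : {poly K}.

Lemma q2_neq1 : q ^+ 2 - 1 != 0.
Proof. by rewrite subr_eq0 q_nroot. Qed.

Lemma q2_derivX :
  q2_deriv p q * 'X = (q ^+ 2 - 1)^-1 *: (dilate (q ^+ 2) p - p).
Proof.
rewrite /q2_deriv -/(dilate (q ^+ 2) p); set g := _ - p.
have /divpK gK : ((q ^+ 2 - 1) *: 'X) %| g.
  rewrite dvdpZl ?q2_neq1 // -['X]subr0 -polyC0 dvdp_XsubCl /root.
  by rewrite horner_coef0 coefB coef_dilate expr0 mul1r subrr.
apply: (canRL (scalerK q2_neq1)).
by rewrite -[RHS]gK -scalerAr.
Qed.

(** The polynomial f such that the product x_(-t) x_t is f(z). *)
Definition xx_poly (t : bool) := if t then dilate (q ^+ 2) p else p.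

(** The ratio of the image of a monomial in K[z] to Q(p X^m)(z), apart from
    alpha. *)
Definition qeuler_scale (t : bool) (m : nat) : K :=
  (if t then 1 else q ^- (2 * m)) / (q ^+ 2 - 1).

Lemma qeuler_scale_neq0 t m : qeuler_scale t m != 0.
Proof.
rewrite /qeuler_scale mulf_neq0 ?invr_eq0 ?q2_neq1 //.
by case: t; rewrite ?oner_eq0 // invr_eq0 expf_neq0.
Qed.

(** The left-hand side is the polynomial of [skew_Kz] for c = q p_(q^2).  Both
    signs lead to the same Q(p X^m): exchanging the signs replaces q by q^-1
    and p by p(q^2 X), which leaves c unchanged. *)
Lemma qeuler_q2_deriv t m :
  (spow q t)^-1 *: ((q *: q2_deriv p q) * 'X^(m.+1))
    + (spow q t ^+ m * sym_bracket (spow q t) m.+1) *: (xx_poly t * 'X^m)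
  = qeuler_scale t m *: qeuler (p * 'X^m).
Proof.
rewrite exprS mulrA -[_ *: q2_deriv p q * 'X]scalerAl q2_derivX.
rewrite /qeuler dilateM dilateXn -scalerAr.
set P' := dilate _ p; set Y := 'X^m.
rewrite -!scalerAl mulrBl !scalerBr !scalerA.
have q21 : q * q - 1 != 0 by rewrite -expr2 q2_neq1.
have qm : q ^+ m != 0 by rewrite expf_neq0.
have q2m : (q ^+ 2) ^+ m = q ^+ m * q ^+ m by rewrite -expr2 -!exprM mulnC.
rewrite /xx_poly /qeuler_scale /sym_bracket exprM q2m; case: t; rewrite /spow.
  rewrite addrAC -scalerDl; congr (_ *: _ - _ *: _).
    by rewrite [q ^+ m.+1]exprS; field; rewrite q_neq0 q21 qm.
  by field; rewrite q_neq0 q21.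
rewrite -addrA -scaleNr -scalerDl -scaleNr; congr (_ *: _ + _ *: _).
  by field; rewrite q2_neq1 qm q_neq0 oner_eq0.
rewrite !exprVn [q ^+ m.+1]exprS; field.
by rewrite q_neq0 q21 qm oner_eq0 mulNr subr_eq0 eq_sym -subr_eq0.
Qed.

End QEuler.

(** * Linear maps that kill the multiples of p *)

(** [L] stands for g |-> Lambda(Q(g)(z)) and [v j] for Lambda(z^j). *)
Section QRecurrence.
Variables (K : fieldType) (q : K) (p : {poly K}) (V : lmodType K).
Variables (v : nat -> V) (L : {linear {poly K} -> V}).
Hypothesis q_nroot : forall k : nat, (0 < k)%N -> q ^+ k != 1.
Hypothesis p_neq0 : p != 0.
Notation n := (size p).-1.

Lemma qpow_sub1_neq0 j : q ^+ (2 * j.+1) - 1 != 0.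
Proof. by rewrite subr_eq0 q_nroot // muln_gt0. Qed.

(** Q multiplies each coefficient by a nonzero scalar, so p g has degree less
    than n like [c], which forces g = 0. *)
Lemma qeuler_multiple_small (c : {poly K}) g :
  (forall j, (n <= j)%N -> c`_j = 0) ->
  c = qeuler q (p * g) -> c = 0.
Proof.
move=> cn cE.
suff g0 : g = 0 by rewrite cE g0 mulr0 linear0.
apply/eqP/negPn/negP => g0.
have pg0 : p * g != 0 by rewrite mulf_neq0.
have : (size (p * g)%R <= n)%N.
  apply/leq_sizeP => j nj; have := cn _ nj; rewrite cE coef_qeuler.
  by move/eqP; rewrite mulf_eq0 (negPf (qpow_sub1_neq0 j)) => /eqP.
rewrite size_mul // leqNgt => /negP; apply.
move: p_neq0 g0; rewrite -!size_poly_gt0.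
by case: (size p) (size g) => [|a] [|b] // _ _; rewrite addnS /= ltnS leq_addr.
Qed.

Hypothesis LXn : forall j, L 'X^j = (q ^+ (2 * j.+1) - 1) *: v j.
Hypothesis Lp : forall f, L (p * f) = 0.

Lemma q_solve j : v j = (q ^+ (2 * j.+1) - 1)^-1 *: L 'X^j.
Proof. by rewrite LXn scalerA mulVf ?scale1r // qpow_sub1_neq0. Qed.

(** X^k is replaced by its remainder modulo p. *)
Lemma q_span k : spanned (fun i : 'I_n => v i) (v k).
Proof.
rewrite q_solve; apply: spannedZ.
have -> : L 'X^k = L (modp 'X^k p).
  by rewrite {1}(divp_eq 'X^k p) linearD mulrC Lp add0r.
have sz : (size (modp 'X^k p) <= n)%N.
  by rewrite -ltnS prednK ?size_poly_gt0 // ltn_modp.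
rewrite -[modp _ _]coefK poly_def linear_sum; apply: spanned_sum => i.
rewrite linearZ /= LXn; do 2!apply: spannedZ.
exact: (spanned_gen (fun i : 'I_n => v i) (widen_ord sz i)).
Qed.

Lemma q2_bracket_ratio i k :
  q2_bracket q i.+1 / q2_bracket q k.+1
  = (q ^+ (2 * k.+1) - 1)^-1 * (q ^+ (2 * i.+1) - 1).
Proof.
have h j : 1 - q ^+ (2 * j.+1) != 0.
  by rewrite -opprB oppr_eq0 qpow_sub1_neq0.
have h0 := h 0; rewrite muln1 in h0; have h1 := qpow_sub1_neq0 k.
rewrite /q2_bracket; field.
by rewrite h1 h0 h.
Qed.

Variables (mu : int -> K) (beta : nat -> int -> K).
Hypothesis muE : (lead_coef p)^-1 *: p = 'X^n - \sum_(i < n) mu i%:Z *: 'X^i.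
Hypothesis mu_neg : forall l : int, l < 0 -> mu l = 0.
Hypothesis beta_neg : forall (i : nat) (l : int), (i < n)%N -> l < 0 -> beta i l = 0.
Hypothesis beta_rec : forall i k : nat, (i < n)%N ->
  beta i k%:Z = \sum_(1 <= j < n.+1) mu (n%:Z - j%:Z) * beta i (k%:Z - j%:Z)
                + mu (i%:Z - k%:Z).

Lemma q_step k : L 'X^(n + k) = \sum_(j < n) mu j%:Z *: L 'X^(j + k).
Proof.
apply/eqP; rewrite -subr_eq0; apply/eqP.
rewrite -[RHS](Lp ((lead_coef p)^-1 *: 'X^k)) -scalerAr scalerAl muE mulrBl -exprD.
rewrite linearB /= mulr_suml [L (\sum_(_ < _) _)]linear_sum; congr (_ - _).
by apply: eq_bigr => j _; rewrite -scalerAl -exprD linearZ.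
Qed.

Lemma beta_rec_ord i k : (i < n)%N -> beta i k%:Z =
  \sum_(j < n) mu j%:Z * beta i (k%:Z + j%:Z - n%:Z) + mu (i%:Z - k%:Z).
Proof.
move=> ltin; rewrite beta_rec // big_add1 /= big_mkord; congr (_ + _).
rewrite (reindex_inj rev_ord_inj); apply: eq_bigr => j _ /=.
by congr (mu _ * beta i _); have := ltn_ord j; lia.
Qed.

(** The [beta i k] are the coefficients of the remainder of X^(n+k) modulo p:
    multiplying the equation of p by X^k expresses X^(n+k) by the X^(j+k) with
    j < n.  Those with j + k >= n are reduced by induction and give the sum in
    the recurrence of beta; the others are already reduced and give its last
    term. *)
Lemma q_reduce k : L 'X^(n + k) = \sum_(i < n) beta i k%:Z *: L 'X^i.
Proof.
elim/ltn_ind: k => k IHk; rewrite q_step.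
under [RHS]eq_bigr => i _ do rewrite beta_rec_ord // scalerDl scaler_suml.
rewrite big_split exchange_big /=.
(* The terms mu (i - k), shifted to the exponents i = j + k. *)
have tail : \sum_(i < n) mu (i%:Z - k%:Z) *: L 'X^i
    = \sum_(j < n) (if (j + k < n)%N then mu j%:Z *: L 'X^(j + k) else 0).
  have [kn|nk] := leqP k n; last first.
    rewrite !big1 // => i _; first by case: ltnP => // ?; lia.
    by rewrite mu_neg ?scale0r //; have := ltn_ord i; lia.
  rewrite -(big_mkord xpredT (fun i => mu (i%:Z - k%:Z) *: L 'X^i)).
  rewrite (big_cat_nat (n := k)) //= big_nat big1 ?add0r => [|i /andP[_ ik]]; last first.
    by rewrite mu_neg ?scale0r //; lia.
  rewrite -[X in \sum_(X <= _ < _) _]add0n big_addn.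
  rewrite -(big_mkord xpredT (fun j => if (j + k < n)%N then mu j%:Z *: L 'X^(j + k) else 0)).
  rewrite [RHS](big_cat_nat (n := n - k)) ?leq_subr //=.
  rewrite [X in _ = _ + X]big_nat [X in _ = _ + X]big1 ?addr0 => [|j /andP[jk _]]; last first.
    by case: ltnP => // ?; lia.
  rewrite !big_nat; apply: eq_bigr => j /andP[_ jk].
  rewrite ifT; last by lia.
  by congr (mu _ *: _); lia.
rewrite tail -big_split; apply: eq_bigr => j _ /=.
under eq_bigr => i _ do rewrite -scalerA.
rewrite -scaler_sumr; case: ltnP => jk.
  rewrite big1 ?scaler0 ?add0r // => i _.
  by rewrite beta_neg ?scale0r //; lia.
rewrite addr0; have -> : (j + k = n + (j + k - n))%N by rewrite subnKC.
rewrite IHk; last by rewrite ltn_subLR // ltn_add2r.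
congr (_ *: _); apply: eq_bigr => i _; congr (beta i _ *: _).
by rewrite -subzn // PoszD [k%:Z + _]addrC.
Qed.

Lemma q_recurrence k : v (n + k) =
  \sum_(i < n) (q2_bracket q i.+1 / q2_bracket q (n + k).+1 * beta i k%:Z) *: v i.
Proof.
rewrite q_solve q_reduce scaler_sumr; apply: eq_bigr => i _.
by rewrite LXn !scalerA q2_bracket_ratio mulrAC -mulrA.
Qed.

End QRecurrence.

(** * Morphisms out of the algebra *)

Section Generation.
Variables (K : fieldType) (p : {poly K}) (q : K).
Notation A := (gwa p q).

Lemma free_mon_prod (I : choiceType) (m : {fmonom I}) :
  \prod_(i <- m) free_gen K i = << m >> :> free_alg K I.
Proof.
case: m => s /=; elim: s => [|i s IHs]; first by rewrite big_nil -fmoneE.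
rewrite big_cons IHs /free_gen fmuE.
rewrite [LHS](@malgMEw _ _ [fset FMonom [:: i]]%fset [fset FMonom s]%fset) ?msuppU1 //.
rewrite !big_seq_fset1 !mcoeffUU mulr1; congr (<< _ *g _ >>).
by apply/eqP; rewrite fmP fmM.
Qed.

Lemma gwa_ind (P : A -> Prop) :
    P 1 -> (forall s a, P a -> P (gwa_x p q s * a)) ->
    (forall s a, P a -> P (gwa_z p q s * a)) ->
    (forall k a b, P a -> P b -> P (k *: a + b)) ->
  forall a, P a.
Proof.
move=> P1 Px Pz PD a; have [u ->] := gwa_pi_surj a.
have P0 : P 0 by have:= PD (-1) 1 1 P1 P1; rewrite scaleN1r addNr.
have Pmon (s : seq (bool * bool)) : P (gwa_pi p q (\prod_(i <- s) free_gen K i)).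
  elim: s => [|[b s'] s IHs]; first by rewrite big_nil rmorph1.
  rewrite big_cons rmorphM; case: b.
    by have:= Px s' _ IHs; rewrite /gwa_x -lock.
  by have:= Pz s' _ IHs; rewrite /gwa_z -lock.
rewrite [u]monalgE raddf_sum; elim/big_rec: _ => // m v _ Pv.
have -> : << u@_m *g m >> = u@_m *: \prod_(i <- m) free_gen K i.
  by rewrite free_mon_prod; apply/esym/(etrans (scale_malgU _ _ _)); rewrite mulr1.
by rewrite /= linearZ; exact: PD (Pmon m) Pv.
Qed.

Lemma gwa_lrmorph_ext (B : algType K) (f g : {lrmorphism A -> B}) :
    (forall s, f (gwa_x p q s) = g (gwa_x p q s)) ->
    (forall s, f (gwa_z p q s) = g (gwa_z p q s)) ->
  f =1 g.
Proof.
move=> fgx fgz; apply: gwa_ind => [|s a IH|s a IH|k a b IHa IHb].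
- by rewrite !rmorph1.
- by rewrite !rmorphM /= fgx IH.
- by rewrite !rmorphM /= fgz IH.
by rewrite !linearP /= IHa IHb.
Qed.

(** [gwa_lift] with the proof of the relations as an argument, so that the
    morphism structure can be inferred from the term. *)
Definition gwa_hom (B : algType K) (X Z : bool -> B) (quad : gwa_quad p q X Z)
  (a : A) : B := gwa_lift X Z a.

HB.instance Definition _ (B : algType K) (X Z : bool -> B) quad :=
  GRing.isZmodMorphism.Build A B (@gwa_hom B X Z quad) (gwa_liftB quad).
HB.instance Definition _ (B : algType K) (X Z : bool -> B) quad :=
  GRing.isMonoidMorphism.Build A B (@gwa_hom B X Z quad) (gwa_liftM quad).
HB.instance Definition _ (B : algType K) (X Z : bool -> B) quad :=
  GRing.isScalable.Build K A B *:%R (@gwa_hom B X Z quad) (gwa_liftZ quad).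

Lemma gwa_hom_x B X Z (quad : @gwa_quad K p q B X Z) s :
  gwa_hom quad (gwa_x p q s) = X s.
Proof. exact: gwa_lift_x quad s. Qed.

Lemma gwa_hom_z B X Z (quad : @gwa_quad K p q B X Z) s :
  gwa_hom quad (gwa_z p q s) = Z s.
Proof. exact: gwa_lift_z quad s. Qed.

End Generation.

(** * Commutation and spanning monomials *)

Section Monomials.
Variables (K : fieldType) (p : {poly K}) (q : K).
Hypothesis q_neq0 : q != 0.
Notation A := (gwa p q).
Notation xp := (gwa_x p q true).
Notation xm := (gwa_x p q false).
Notation zp := (gwa_z p q true).
Notation zm := (gwa_z p q false).
Notation z := (gwa_zz p q).

Lemma gwa_zC : zp * zm = zm * zp.
Proof. exact/subr0_eq/gwa_quad_gen/gwa_rel_zz. Qed.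
Lemma gwa_xpz s : xp * gwa_z p q s = q^-1 *: (gwa_z p q s * xp).
Proof. exact/subr0_eq/gwa_quad_gen/gwa_rel_xpz. Qed.
Lemma gwa_xmz s : xm * gwa_z p q s = q *: (gwa_z p q s * xm).
Proof. exact/subr0_eq/gwa_quad_gen/gwa_rel_xmz. Qed.
Lemma gwa_xpxm : xp * xm = horner_alg z p.
Proof. exact/subr0_eq/gwa_quad_gen/gwa_rel_xpxm. Qed.

Lemma gwa_xmxp : xm * xp = horner_alg z (dilate (q ^+ 2) p).
Proof.
rewrite horner_alg_dilate /gwa_zz gwa_zC.
exact/subr0_eq/gwa_quad_gen/gwa_rel_xmxp.
Qed.

Lemma gwa_zx s t :
  gwa_z p q s * gwa_x p q t = spow q t *: (gwa_x p q t * gwa_z p q s).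
Proof.
case: t; first by rewrite gwa_xpz scalerA mulfV ?scale1r.
by rewrite gwa_xmz scalerA mulVf ?scale1r.
Qed.

Definition zmon (m l : nat) : A := zp ^+ m * zm ^+ l.

Lemma gwa_zXC m l : zp ^+ m * zm ^+ l = zm ^+ l * zp ^+ m.
Proof. by apply/commrX/commr_sym/commrX; rewrite /GRing.comm gwa_zC. Qed.

Lemma gwa_zzX k : z ^+ k = zp ^+ k * zm ^+ k.
Proof. by rewrite /gwa_zz exprMn_comm //; exact: gwa_zC. Qed.

Lemma gwa_monoE e m l :
  gwa_mono p q (e, m, l) = gwa_x p q (0 <= e) ^+ `|e|%N * zmon m l.
Proof. by rewrite /zmon mulrA; case: e. Qed.

Lemma gwa_mono_zz k : gwa_mono p q (0, k, k) = z ^+ k.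
Proof. by rewrite gwa_monoE mul1r gwa_zzX. Qed.

Local Notation span := (spanned (@gwa_mono K p q)).

Lemma gwa_z_zmon s m l : exists m' l', gwa_z p q s * zmon m l = zmon m' l'.
Proof.
rewrite /zmon; case: s; first by exists m.+1, l; rewrite exprS mulrA.
by exists m, l.+1; rewrite gwa_zXC mulrA -exprS -gwa_zXC.
Qed.

Lemma gwa_zxX s t r : exists k, gwa_z p q s * gwa_x p q t ^+ r =
  k *: (gwa_x p q t ^+ r * gwa_z p q s).
Proof. by eexists; exact/qcommX/gwa_zx. Qed.

Lemma gwa_span_z s a : span a -> span (gwa_z p q s * a).
Proof.
apply: (spanned_linear (f := gwa_z p q s \*o idfun)) => -[[e m] l].
rewrite -[X in span X]/(gwa_z p q s * gwa_mono p q (e, m, l)) gwa_monoE mulrA.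
have [k ->] := gwa_zxX s (0 <= e) `|e|%N.
rewrite -scalerAl -mulrA; have [m' [l' ->]] := gwa_z_zmon s m l.
by apply: spannedZ; rewrite -gwa_monoE; exact: spanned_gen.
Qed.

Lemma gwa_span_horner g a : span a -> span (horner_alg z g * a).
Proof.
move=> sa; elim/poly_ind: g => [|g c IHg].
  by rewrite rmorph0 mul0r; exact: spanned0.
rewrite [g * _]mulrC rmorphD rmorphM /= horner_algX horner_algC.
rewrite mulrDl mulr_algl; apply: spannedD; last exact: spannedZ.
by rewrite /gwa_zz -!mulrA; do 2!apply: gwa_span_z.
Qed.

(** The only case that is not immediate is that of x_s next to a power of the
    opposite generator: the relations replace their product by a polynomial
    in z. *)
Lemma gwa_span_x s a : span a -> span (gwa_x p q s * a).
Proof.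
apply: (spanned_linear (f := gwa_x p q s \*o idfun)) => -[[e m] l].
rewrite -[X in span X]/(gwa_x p q s * gwa_mono p q (e, m, l)) gwa_monoE mulrA.
have sx t r : span (gwa_x p q t ^+ r * zmon m l).
  case: t r => [r|[|r]].
  - by have := spanned_gen (@gwa_mono K p q) (Posz r, m, l); rewrite gwa_monoE.
  - by have := spanned_gen (@gwa_mono K p q) (Posz 0, m, l); rewrite gwa_monoE.
  by have := spanned_gen (@gwa_mono K p q) (Negz r, m, l); rewrite gwa_monoE.
case: s; case: e => r /=.
- by rewrite -exprS.
- by rewrite exprS mulrA gwa_xpxm -mulrA; apply: gwa_span_horner.
- case: r => [|r]; first by rewrite expr0 mulr1; apply: (sx false 1).
  by rewrite exprS mulrA gwa_xmxp -mulrA; apply: gwa_span_horner.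
by rewrite -exprS.
Qed.

Lemma gwa_mono_span a : span a.
Proof.
elim/gwa_ind: a => [|s a|s a|k a b sa sb].
- have := spanned_gen (@gwa_mono K p q) (Posz 0, 0, 0).
  by rewrite gwa_mono_zz.
- exact: gwa_span_x.
- exact: gwa_span_z.
by apply: spannedD => //; apply: spannedZ.
Qed.

End Monomials.

(** * A representation that separates the monomials *)

Section Endomorphisms.
Variables (K : fieldType).
Notation V := (int * int -> {poly K}).

Record endo := Endo { endo_fun :> V -> V ; endoP : linear endo_fun }.

Lemma endo_ext (f g : endo) : f =1 g -> f = g.
Proof.
case: f g => [f Hf] [g Hg] /= /funext fg; move: Hf; rewrite fg => Hf.
by rewrite (Prop_irrelevance Hf Hg).
Qed.

HB.instance Definition _ := gen_eqMixin endo.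
HB.instance Definition _ := gen_choiceMixin endo.

HB.instance Definition _ (f : endo) :=
  GRing.isLinear.Build K V V *:%R f (endoP f).

Definition endo_zero : endo := Endo (linearP (\0 : V -> V)).
Definition endo_opp (f : endo) : endo := Endo (linearP (\- f)).
Definition endo_add (f g : endo) : endo := Endo (linearP (f \+ g)).
Definition endo_scale k (f : endo) : endo := Endo (linearP (k \*: f)).
Definition endo_one : endo := Endo (linearP (idfun : V -> V)).
Definition endo_mul (f g : endo) : endo := Endo (linearP (f \o g)).

Fact endo_addA : associative endo_add.
Proof. by move=> f g h; apply: endo_ext => v /=; rewrite addrA. Qed.
Fact endo_addC : commutative endo_add.
Proof. by move=> f g; apply: endo_ext => v /=; rewrite addrC. Qed.
Fact endo_add0 : left_id endo_zero endo_add.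
Proof. by move=> f; apply: endo_ext => v /=; rewrite add0r. Qed.
Fact endo_addN : left_inverse endo_zero endo_opp endo_add.
Proof. by move=> f; apply: endo_ext => v /=; rewrite addNr. Qed.

HB.instance Definition _ :=
  GRing.isZmodule.Build endo endo_addA endo_addC endo_add0 endo_addN.

Fact endo_mulA : associative endo_mul.
Proof. by move=> f g h; apply: endo_ext. Qed.
Fact endo_mul1l : left_id endo_one endo_mul.
Proof. by move=> f; apply: endo_ext. Qed.
Fact endo_mul1r : right_id endo_one endo_mul.
Proof. by move=> f; apply: endo_ext. Qed.
Fact endo_mulDl : left_distributive endo_mul endo_add.
Proof. by move=> f g h; apply: endo_ext. Qed.
Fact endo_mulDr : right_distributive endo_mul endo_add.
Proof. by move=> f g h; apply: endo_ext => v /=; rewrite linearD. Qed.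
Fact endo_one_neq0 : endo_one != endo_zero.
Proof.
apply/eqP=> /(congr1 (fun f : endo => f (fun=> 1) (0, 0)))/eqP.
by rewrite /= oner_eq0.
Qed.

HB.instance Definition _ := GRing.Zmodule_isNzRing.Build endo
  endo_mulA endo_mul1l endo_mul1r endo_mulDl endo_mulDr endo_one_neq0.

Fact endo_scaleA a b f : endo_scale a (endo_scale b f) = endo_scale (a * b) f.
Proof. by apply: endo_ext => v /=; rewrite scalerA. Qed.
Fact endo_scale1 : left_id 1 endo_scale.
Proof. by move=> f; apply: endo_ext => v /=; rewrite scale1r. Qed.
Fact endo_scaleDr : right_distributive endo_scale +%R.
Proof. by move=> a f g; apply: endo_ext => v /=; rewrite scalerDr. Qed.
Fact endo_scaleDl f : {morph endo_scale^~ f : a b / a + b}.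
Proof. by move=> a b; apply: endo_ext => v /=; rewrite scalerDl. Qed.

HB.instance Definition _ := GRing.Zmodule_isLmodule.Build K endo
  endo_scaleA endo_scale1 endo_scaleDr endo_scaleDl.

Fact endo_scaleAl (k : K) (f g : endo) : k *: (f * g) = (k *: f) * g.
Proof. by apply: endo_ext. Qed.

HB.instance Definition _ := GRing.Lmodule_isLalgebra.Build K endo endo_scaleAl.

Fact endo_scaleAr (k : K) (f g : endo) : k *: (f * g) = f * (k *: g).
Proof. by apply: endo_ext => v /=; rewrite linearZ. Qed.

HB.instance Definition _ := GRing.Lalgebra_isAlgebra.Build K endo endo_scaleAr.

End Endomorphisms.

(** A function f on Z x Z is thought of as the formal sum of the
    x_+^i z_+^j f(i,j), where X stands for z and x_+ and z_+ have been made
    invertible, so that z_- = X z_+^-1 and x_- = p(q^2 X) x_+^-1.  The algebra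
    acts on such sums by left multiplication, and the powers of q come from
    moving z_+, z_- and X past x_+^i. *)
Section Representation.
Variables (K : fieldType) (p : {poly K}) (q : K).
Hypothesis q_neq0 : q != 0.
Notation V := (int * int -> {poly K}).
Notation A := (gwa p q).

Definition rep_x_fun (s : bool) (f : V) : V := fun ij =>
  if s then f (ij.1 - 1, ij.2)
  else dilate (q ^ (2 * ij.1 + 2)) p * f (ij.1 + 1, ij.2).

Definition rep_z_fun (s : bool) (f : V) : V := fun ij =>
  q ^ ij.1 *: (if s then f (ij.1, ij.2 - 1) else 'X * f (ij.1, ij.2 + 1)).

Fact rep_x_linear s : linear (rep_x_fun s).
Proof.
move=> k f g; apply/funext => -[i j]; case: s => //.
by rewrite [LHS]mulrDr -scalerAr.
Qed.

Fact rep_z_linear s : linear (rep_z_fun s).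
Proof.
move=> k f g; apply/funext => -[i j]; case: s.
  by rewrite [LHS]scalerDr !scalerA mulrC -scalerA.
rewrite [LHS](congr1 (fun h => q ^ i *: h) (mulrDr _ _ _)).
by rewrite scalerDr -scalerAr !scalerA mulrC -scalerA.
Qed.

Definition rep_x s : endo K := Endo (rep_x_linear s).
Definition rep_z s : endo K := Endo (rep_z_linear s).

Lemma endo_mulE (f g : endo K) v : (f * g) v = f (g v). Proof. by []. Qed.
Lemma endo_subE (f g : endo K) v ij : (f - g) v ij = f v ij - g v ij.
Proof. by []. Qed.
Lemma endo_scaleE k (f : endo K) v ij : (k *: f) v ij = k *: f v ij.
Proof. by []. Qed.
Lemma rep_xp v i j : rep_x true v (i, j) = v (i - 1, j). Proof. by []. Qed.
Lemma rep_xm v i j :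
  rep_x false v (i, j) = dilate (q ^ (2 * i + 2)) p * v (i + 1, j).
Proof. by []. Qed.
Lemma rep_zp v i j : rep_z true v (i, j) = q ^ i *: v (i, j - 1).
Proof. by []. Qed.
Lemma rep_zm v i j : rep_z false v (i, j) = q ^ i *: ('X * v (i, j + 1)).
Proof. by []. Qed.
Definition repE := (endo_mulE, endo_subE, endo_scaleE, rep_xp, rep_xm, rep_zp, rep_zm).

Lemma endo_horner (h : endo K) (c : int -> K) (g : {poly K}) :
    (forall f i j, h f (i, j) = (c i *: 'X) * f (i, j)) ->
  forall f i j, horner_alg h g f (i, j) = dilate (c i) g * f (i, j).
Proof.
move=> hE f i j; rewrite /dilate; elim/poly_ind: g f => [|g k IHg] f.
  by rewrite rmorph0 comp_poly0 mul0r.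
rewrite rmorphD rmorphM /= horner_algX horner_algC.
rewrite comp_polyD comp_polyM comp_polyX comp_polyC mulrDl.
by rewrite -mulrA -hE -IHg mul_polyC.
Qed.

Lemma rep_zz f i j :
  (rep_z true * rep_z false) f (i, j) = (q ^ (2 * i) *: 'X) * f (i, j).
Proof.
rewrite !repE subrK scalerA -scalerAl; congr (_ *: _).
by rewrite -expfzDr //; congr (_ ^ _); lia.
Qed.

Lemma rep_quad : gwa_quad p q rep_x rep_z.
Proof.
have zzE' f i j :
    (rep_z false * rep_z true) f (i, j) = (q ^ (2 * i) *: 'X) * f (i, j).
  rewrite !repE addrK -scalerAr scalerA -scalerAl; congr (_ *: _).
  by rewrite -expfzDr //; congr (_ ^ _); lia.
move=> u rel; apply: endo_ext => f; apply/funext=> -[i j].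
case: rel => [|s|s||] {u}; apply/eqP; rewrite repE subr_eq0; apply/eqP.
- by rewrite rep_zz zzE'.
- have q1 : q ^ (i - 1) = q^-1 * q ^ i by rewrite addrC expfzDr.
  by case: s; rewrite !repE scalerA q1.
- have q1 : q ^ (i + 1) = q * q ^ i by rewrite addrC expfzDr.
  by case: s; rewrite !repE -scalerAr scalerA q1 // [X in _ = _ *: X]mulrCA.
- rewrite (endo_horner (c := fun i => q ^ (2 * i))) // => [|? ? ?]; last exact: rep_zz.
  rewrite !repE subrK; congr (dilate (q ^ _) _ * _); lia.
rewrite (endo_horner (c := fun i => q ^ (2 * i + 2))) => [|g {}i {}j].
  by rewrite !repE addrK.
by rewrite endo_scaleE zzE' -!scalerAl scalerA addrC expfzDr.
Qed.

Local Notation rep := (gwa_hom rep_quad).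

Definition delta (e j : int) (g : {poly K}) : V :=
  fun ij => if ij == (e, j) then g else 0.

Lemma deltaP v i j g :
  v (i, j) = g -> (forall k, k != (i, j) -> v k = 0) -> v = delta i j g.
Proof. by move=> vg v0; apply/funext=> k; rewrite /delta; case: eqVneq => [->|/v0]. Qed.

Lemma delta_eq i j g : delta i j g (i, j) = g.
Proof. by rewrite /delta eqxx. Qed.

Lemma delta_neq i j g k : k != (i, j) -> delta i j g k = 0.
Proof. by rewrite /delta => /negPf ->. Qed.

Lemma rep_xp_delta i j g : rep_x true (delta i j g) = delta (i + 1) j g.
Proof.
apply: deltaP => [|[i' j'] ne]; first by rewrite rep_xp addrK delta_eq.
by rewrite rep_xp delta_neq //; apply: contra_neq ne => -[<- <-]; rewrite subrK.
Qed.

Lemma rep_xm_delta i j g :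
  rep_x false (delta i j g) = delta (i - 1) j (dilate (q ^ (2 * i)) p * g).
Proof.
apply: deltaP => [|[i' j'] ne].
  by rewrite rep_xm subrK delta_eq; congr (dilate (q ^ _) _ * _); lia.
rewrite rep_xm delta_neq ?mulr0 //.
by apply: contra_neq ne => -[<- <-]; rewrite addrK.
Qed.

Lemma rep_zp_delta j g : rep_z true (delta 0 j g) = delta 0 (j + 1) g.
Proof.
apply: deltaP => [|[i' j'] ne].
  by rewrite rep_zp addrK delta_eq expr0z scale1r.
rewrite rep_zp delta_neq ?scaler0 //.
by apply: contra_neq ne => -[-> <-]; rewrite subrK.
Qed.

Lemma rep_zm_delta j g : rep_z false (delta 0 j g) = delta 0 (j - 1) ('X * g).
Proof.
apply: deltaP => [|[i' j'] ne].
  by rewrite rep_zm subrK delta_eq expr0z scale1r.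
rewrite rep_zm delta_neq ?mulr0 ?scaler0 //.
by apply: contra_neq ne => -[-> <-]; rewrite addrK.
Qed.

(** The polynomial created by x_-^r (for e = -r): each x_- contributes a
    dilation of p. *)
Definition mono_weight (e : int) : {poly K} :=
  \prod_(k < if e is Posz _ then 0%N else `|e|%N) dilate (q ^ (- (2 * k%:Z))) p.

Lemma mono_weight_neq0 e : p != 0 -> mono_weight e != 0.
Proof.
move=> p0; apply/prodf_neq0 => k _; apply: dilate_neq0 => //.
exact: expfz_neq0.
Qed.

(** The action on the function that represents 1. *)
Definition rep_unit (a : A) : V := rep a (delta 0 0 1).

Fact rep_unit_linear : linear rep_unit.
Proof. by move=> k a b; rewrite /rep_unit linearP. Qed.

HB.instance Definition _ :=
  GRing.isLinear.Build K A V *:%R rep_unit rep_unit_linear.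

Lemma rep_unit_mono e m l :
  rep_unit (gwa_mono p q (e, m, l))
  = delta e (m%:Z - l%:Z) (mono_weight e * 'X^l).
Proof.
have zm : rep (gwa_z p q false ^+ l) (delta 0 0 1) = delta 0 (- l%:Z) 'X^l.
  elim: l => [|l IHl]; first by rewrite expr0 rmorph1.
  rewrite exprS rmorphM /= gwa_hom_z ?endo_mulE IHl rep_zm_delta exprS.
  by congr (delta 0 _ _); lia.
have zp g : rep (gwa_z p q true ^+ m) (delta 0 (- l%:Z) g) = delta 0 (m%:Z - l%:Z) g.
  elim: m => [|m IHm]; first by rewrite expr0 rmorph1 add0r.
  rewrite exprS rmorphM /= gwa_hom_z ?endo_mulE IHm rep_zp_delta.
  by congr (delta 0 _ _); lia.
rewrite /rep_unit /gwa_mono !rmorphM /= ?endo_mulE zm zp.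
move: (_ - _) ('X^l) => j g; case: e => r /=.
  rewrite /mono_weight big_ord0 mul1r.
  elim: r => [|r IHr]; first by rewrite expr0 rmorph1.
  rewrite exprS rmorphM /= gwa_hom_x ?endo_mulE IHr rep_xp_delta.
  by congr (delta _ _ _); lia.
rewrite /mono_weight NegzE abszN absz_nat.
move: r.+1 => {}r.
elim: r => [|r IHr]; first by rewrite big_ord0 mul1r expr0 rmorph1.
rewrite exprS rmorphM /= gwa_hom_x ?endo_mulE IHr rep_xm_delta big_ord_recr /=.
rewrite [in RHS]mulrAC [in RHS]mulrC.
by congr (delta _ _ (dilate (q ^ _) _ * _)); lia.
Qed.

(** Two monomials are sent to the same point of Z x Z only if they have the
    same [e] and the same [m - l]; then the powers of X distinguish them. *)
Lemma gwa_mono_free : p != 0 -> forall (s : seq (int * nat * nat)) c,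
  uniq s -> \sum_(u <- s) c u *: gwa_mono p q u = 0 -> {in s, forall u, c u = 0}.
Proof.
move=> p0 s c us s0 [[e m] l] su.
have /(congr1 (fun v => v (e, m%:Z - l%:Z))) : rep_unit 0 = 0 by exact: linear0.
rewrite -s0 linear_sum fct_sumE /= => sum0.
pose hit (u : int * nat * nat) :=
  (u.1.1 == e) && (u.1.2%:Z - u.2%:Z == m%:Z - l%:Z).
have : mono_weight e * (\sum_(u <- s | hit u) c u *: 'X^(u.2)) = 0.
  rewrite -[RHS]sum0 mulr_sumr big_mkcond; apply: eq_bigr => -[[e' m'] l'] _.
  rewrite linearZ -[RHS]/(_ *: rep_unit _ _) rep_unit_mono /delta xpair_eqE /hit /=.
  rewrite [e == _]eq_sym [_ - _ == m'%:Z - _]eq_sym.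
  case: eqP => [->|_] /=; last by rewrite scaler0.
  by case: eqP; rewrite ?scaler0 ?scalerAr.
move/eqP; rewrite mulf_eq0 (negPf (mono_weight_neq0 _ p0)) /=.
move/eqP/(congr1 (fun g : {poly K} => g`_l)).
rewrite coef0 coef_sum big_mkcond (bigD1_seq (e, m, l)) //= big1 => [|[[e' m'] l'] ne].
  by rewrite /hit !eqxx coefZ coefXn eqxx mulr1 addr0.
case: ifP => //= /andP[/= /eqP ee /eqP ml]; rewrite coefZ coefXn.
case: eqP => [ll|_]; last by rewrite mulr0.
case/negP: ne; apply/eqP; congr (_, _, _) => //; lia.
Qed.

Lemma gwa_mono_basis : p != 0 -> linear_basis (@gwa_mono K p q).
Proof.
move=> p0; split; first exact: gwa_mono_free.
by move=> v; have [s _ [c ->]] := gwa_mono_span q_neq0 v; exists s, c.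
Qed.

(** The projection of A onto K[z] along the other monomials. *)
Definition gwa_proj (a : A) : {poly K} := rep_unit a (0, 0).

Fact gwa_proj_linear : linear gwa_proj.
Proof. by move=> k a b; rewrite /gwa_proj linearP. Qed.

HB.instance Definition _ :=
  GRing.isLinear.Build K A {poly K} *:%R gwa_proj gwa_proj_linear.

Lemma gwa_proj_mono e m l :
  gwa_proj (gwa_mono p q (e, m, l)) = if (e == 0) && (m == l) then 'X^l else 0.
Proof.
rewrite /gwa_proj rep_unit_mono /delta xpair_eqE [0 == e]eq_sym [0 == _]eq_sym subr_eq0.
case: eqP => //= ->; rewrite /mono_weight big_ord0 mul1r; congr (if _ then _ else _); lia.
Qed.

Lemma gwa_proj_horner f : gwa_proj (horner_alg (gwa_zz p q) f) = f.
Proof.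
rewrite /gwa_proj /rep_unit lrmorph_horner_alg /gwa_zz rmorphM /= !gwa_hom_z.
rewrite (endo_horner (c := fun i => q ^ (2 * i))) ?delta_eq; last exact: rep_zz.
by rewrite mulr1 mulr0 expr0z dilate1.
Qed.

Lemma gwa_mono_in_Kz e m l : p != 0 ->
  gwa_in_Kz (gwa_mono p q (e, m, l)) -> (e == 0) && (m == l).
Proof.
move=> p0 [f fE]; apply/negPn/negP => ne.
have f0 : f = 0.
  by rewrite -[f]gwa_proj_horner -fE gwa_proj_mono (negPf ne).
have := gwa_mono_free p0 (s := [:: (e, m, l)]) (c := fun=> 1) isT.
rewrite big_seq1 fE f0 rmorph0 scaler0 => /(_ erefl _ (mem_head _ _)).
by move/eqP; rewrite oner_eq0.
Qed.

End Representation.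

(** * The bigrading *)

Section Grading.
Variables (K : fieldType) (p : {poly K}) (q : K).
Notation A := (gwa p q).
Notation x := (gwa_x p q).
Notation z := (gwa_z p q).
Notation zz := (gwa_zz p q).

(** The relations are homogeneous for the degree in the x's and for the degree
    in the z's separately; [la] and [mu] are the corresponding scalings. *)
Fact grade_quad la mu : la != 0 -> mu != 0 ->
  gwa_quad p q (fun s => spow la s *: x s) (fun s => spow mu s *: z s).
Proof.
move=> la0 mu0 u; case=> [|s|s||]; apply/eqP; rewrite subr_eq0; apply/eqP.
- by rewrite (spow_mul true) // (spow_mul false) // gwa_zC.
- exact/qcommZ/gwa_xpz.
- exact/qcommZ/gwa_xmz.
- by rewrite (spow_mul true) // (spow_mul true) // gwa_xpxm.
by rewrite (spow_mul false) // (spow_mul false) // -gwa_zC gwa_xmxp horner_alg_dilate.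
Qed.

Section Grade.
Variables (la mu : K) (la0 : la != 0) (mu0 : mu != 0).
Notation grade := (gwa_hom (grade_quad la0 mu0)).

Lemma grade_zz : grade zz = zz.
Proof.
by rewrite /gwa_zz rmorphM /= !gwa_hom_z /= scaler_mul mulfV // scale1r.
Qed.

Lemma grade_mono e m l :
  grade (gwa_mono p q (e, m, l)) = (la ^ e * mu ^ (m%:Z - l%:Z)) *: gwa_mono p q (e, m, l).
Proof.
have muE : mu ^ (m%:Z - l%:Z) = mu ^+ m * mu^-1 ^+ l.
  by rewrite expfzDr // -exprnP -exprnN exprVn.
have -> : la ^ e = spow la (0 <= e) ^+ `|e|%N.
  by case: e => r //; rewrite NegzE -exprnN -exprVn.
rewrite gwa_monoE muE /zmon !rmorphM !rmorphXn /= gwa_hom_x !gwa_hom_z !exprZn.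
exact: scaler_mul3.
Qed.

Hypothesis q_neq0 : q != 0.

Lemma proj_grade a : gwa_proj q_neq0 (grade a) = gwa_proj q_neq0 a.
Proof.
move: a (gwa_mono_span q_neq0 a).
apply: (linear_ext_span (f := gwa_proj q_neq0 \o grade)) => -[[e m] l].
rewrite -[LHS]/(gwa_proj q_neq0 (grade (gwa_mono p q (e, m, l)))) grade_mono.
rewrite linearZ /= -[RHS]/(gwa_proj q_neq0 (gwa_mono p q (e, m, l))) gwa_proj_mono.
case: ifP => [/andP[/eqP-> /eqP->]|]; last by rewrite scaler0.
by rewrite subrr !expr0z mul1r scale1r.
Qed.

End Grade.

Lemma skew_comm (s phi : {lrmorphism A -> A}) (D : {linear A -> A}) (w : K) :
    skew_derivation s D -> (forall a, phi (s a) = s (phi a)) ->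
    (forall t, phi (D (x t)) = w *: D (phi (x t))) ->
    (forall t, phi (D (z t)) = w *: D (phi (z t))) ->
  forall a, phi (D a) = w *: D (phi a).
Proof.
move=> DM phis Dx Dz.
apply: gwa_ind => [|t a IH|t a IH|k a b IHa IHb].
- by rewrite rmorph1 (skew_one DM) rmorph0 scaler0.
- exact: skew_commM DM phis (Dx t) IH.
- exact: skew_commM DM phis (Dz t) IH.
by rewrite !linearP /= IHa IHb.
Qed.

End Grading.

(** * Right linear forms and divergences *)

Lemma big_ord3 (V : nmodType) (F : 'I_3 -> V) :
  \sum_i F i = F idxm + F idx0 + F idxp.
Proof.
rewrite !big_ord_recl big_ord0 addr0 addrA.
by congr (F _ + F _ + F _); apply: val_inj.
Qed.

Lemma ord3_ind (P : 'I_3 -> Prop) : P idxm -> P idx0 -> P idxp -> forall i, P i.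
Proof.
move=> Pm P0 Pp [[|[|[|i]]] // lti].
- by rewrite (_ : Ordinal _ = idxm) //; apply: val_inj.
- by rewrite (_ : Ordinal _ = idx0) //; apply: val_inj.
by rewrite (_ : Ordinal _ = idxp) //; apply: val_inj.
Qed.

Section FreeCalculus.
Variables (K : fieldType) (A : algType K).
Variables (sigma tau : 'I_3 -> {lrmorphism A -> A}).
Hypothesis sigmaK : forall i, cancel (sigma i) (tau i).
Hypothesis tauK : forall i, cancel (tau i) (sigma i).
Implicit Types (f g : rhom sigma) (a b : A).

(** The right coordinate of [a *: omega i] is [tau i a], since
    omega_i tau_i(a) = a omega_i. *)
Lemma rhom_scale_omega f a i : f (a *: omega A i) = f (omega A i) * tau i a.
Proof.
have [_ <-] := rhomP f; congr (f _); apply/rowP => j; rewrite !mxE eqxx /=.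
by case: eqVneq => [->|_]; rewrite ?mulr0 ?mul0r // mulr1 mul1r tauK.
Qed.

Lemma rhomE f w : f w = \sum_i f (omega A i) * tau i (w 0 i).
Proof.
have [fD _] := rhomP f.
have f0 : f 0 = 0 by apply: (addrI (f 0)); rewrite -fD !addr0.
rewrite {1}[w]row_sum_delta (big_morph f fD f0).
by apply: eq_bigr => i _; rewrite rhom_scale_omega.
Qed.

Lemma rhom_omega_ext f g : (forall i, f (omega A i) = g (omega A i)) -> f = g.
Proof.
by move=> fg; apply: rhom_ext => w; rewrite !rhomE; apply: eq_bigr => i _; rewrite fg.
Qed.

Fact rhom_of_right_linear (a : 'I_3 -> A) :
  right_linear sigma (fun w => \sum_i a i * tau i (w 0 i)).
Proof.
split=> [w1 w2|w b].
  by rewrite -big_split; apply: eq_bigr => i _; rewrite mxE rmorphD mulrDr.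
rewrite mulr_suml; apply: eq_bigr => i _.
by rewrite mxE rmorphM /= sigmaK mulrA.
Qed.

Definition rhom_of (a : 'I_3 -> A) : rhom sigma := RHom (rhom_of_right_linear a).

Lemma rhom_ofE (a : 'I_3 -> A) i : rhom_of a (omega A i) = a i.
Proof.
rewrite /= (bigD1 i) //= big1 => [|j ji].
  by rewrite addr0 mxE !eqxx rmorph1 mulr1.
by rewrite mxE (negPf ji) andbF rmorph0 mulr0.
Qed.

Lemma dual_basis_exists : exists! xi : 'I_3 -> rhom sigma, dual_basis xi.
Proof.
exists (fun i => rhom_of (fun j => (i == j)%:R)); split=> [i j|xi xiP].
  exact: rhom_ofE.
apply/funext => i; apply: rhom_omega_ext => j.
by rewrite rhom_ofE xiP.
Qed.

Lemma dual_basis_expand (xi : 'I_3 -> rhom sigma) f : dual_basis xi ->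
  f = \sum_i rhom_act 1 (xi i) (sigma i (f (omega A i))).
Proof.
move=> xiP; apply: rhom_omega_ext => j.
have sumE (r : seq 'I_3) (F : 'I_3 -> rhom sigma) w :
    (\sum_(i <- r) F i) w = \sum_(i <- r) F i w.
  by elim/big_rec2: _ => // i y z _ <-.
rewrite sumE (bigD1 j) //= big1 ?addr0 => [|i ij].
  by rewrite mul1r rhom_scale_omega xiP eqxx mul1r sigmaK.
by rewrite mul1r rhom_scale_omega xiP (negPf ij) mul0r.
Qed.

Variables (partial : 'I_3 -> {linear A -> A}) (q : K).
Hypothesis partialM : forall i, skew_derivation (sigma i) (partial i).

Notation div := (gwa_div partial q : {linear rhom sigma -> A}).

Lemma divergence_unique xi : dual_basis xi ->
  forall D D' : {linear rhom sigma -> A},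
    is_divergence partial D -> is_divergence partial D' ->
    (forall i, D (xi i) = 0) -> (forall i, D' (xi i) = 0) -> D' =1 D.
Proof.
move=> xiP D D' DP DP' Dxi Dxi' f; rewrite [f](dual_basis_expand _ xiP).
rewrite !linear_sum; apply: eq_bigr => i _.
by rewrite DP DP' Dxi Dxi'.
Qed.

Lemma div_dual_basis xi i : dual_basis xi -> div (xi i) = 0.
Proof.
have d1 j (b : bool) : partial j (b%:R : A) = 0.
  by case: b; rewrite ?raddf0 // (skew_one (partialM j)).
by move=> xiP; rewrite /= /gwa_div !xiP !d1 !scaler0 !addr0.
Qed.

(** The weights of [gwa_div] compensate for the commutation of partial_i with
    tau_i, so that the second term of the Leibniz rule is exactly the value of
    the form at d a. *)
Lemma div_divergence :
    (forall a, partial idxm (tau idxm a) = q ^+ 2 *: tau idxm (partial idxm a)) ->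
    (forall a, partial idx0 (tau idx0 a) = tau idx0 (partial idx0 a)) ->
    (forall a, partial idxp (tau idxp a) = q ^- 2 *: tau idxp (partial idxp a)) ->
  q != 0 -> is_divergence partial div.
Proof.
move=> Pm P0 Pp q0 a f.
have fd : f (omega_d partial a) = \sum_i f (omega A i) * tau i (partial i a).
  rewrite rhomE; apply: eq_bigr => i _; congr (_ * tau _ _).
  rewrite /omega_d summxE (bigD1 i) //= big1 => [|j ji].
    by rewrite !mxE !eqxx mulr1 addr0.
  by rewrite !mxE [i == j]eq_sym (negPf ji) andbF mulr0.
have q2 : q ^+ 2 != 0 by rewrite expf_neq0.
rewrite fd big_ord3 /= /gwa_div /= !mul1r !rhom_scale_omega !partialM !tauK Pm P0 Pp.
rewrite !scalerDr -!scalerAr !scalerA mulVf // mulfV // !scale1r !mulrDl !scalerAl.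
by rewrite [X in X + _ = _]addrACA [LHS]addrACA.
Qed.

End FreeCalculus.

(** * The calculus on the generalized Weyl algebra *)

(** The index of the derivation that kills the generators of sign [t]. *)
Definition side (t : bool) : 'I_3 := if t then idxm else idxp.

Section Calculus.
Variables (K : fieldType) (p : {poly K}) (q : K) (alpha : 'I_3 -> K).
Notation A := (gwa p q).
Notation x := (gwa_x p q).
Notation z := (gwa_z p q).
Notation zz := (gwa_zz p q).
Variables (sigma : 'I_3 -> {lrmorphism A -> A}) (partial : 'I_3 -> {linear A -> A}).
Hypothesis q_neq0 : q != 0.
Hypothesis q_nroot : forall k : nat, (0 < k)%N -> q ^+ k != 1.
Hypothesis alpha_neq0 : forall i, alpha i != 0.
Hypothesis sigmaP : gwa_twists sigma.
Hypothesis partialP : gwa_derivations alpha sigma partial.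
Notation proj := (gwa_proj q_neq0).

Definition twist (i : 'I_3) : K := if i == idx0 then q ^+ 2 else q.

Lemma twist_neq0 i : twist i != 0.
Proof. by rewrite /twist; case: ifP => _; rewrite ?expf_neq0. Qed.

Lemma twistV_neq0 i : (twist i)^-1 != 0.
Proof. by rewrite invr_eq0 twist_neq0. Qed.

Lemma sigmaE i a :
  sigma i a = gwa_hom (@grade_quad K p q _ _ (twist_neq0 i) (twist_neq0 i)) a.
Proof.
have twE (s : bool) : [/\ q ^ (if s then 1 else -1) = spow (twist idxm) s,
    q ^ (2 * (if s then 1 else -1)) = spow (twist idx0) s
  & q ^ (if s then 1 else -1) = spow (twist idxp) s].
  by case: s; split; rewrite /twist /= ?exprN1.
move: a; apply: gwa_lrmorph_ext => s /=; have [wm w0 wp] := twE s;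
  [rewrite gwa_hom_x | rewrite gwa_hom_z]; move: i; apply: ord3_ind.
- by have [-> _ _] := sigmaP (gwa_homog_x p q s); rewrite wm.
- by have [_ -> _] := sigmaP (gwa_homog_x p q s); rewrite w0.
- by have [_ _ ->] := sigmaP (gwa_homog_x p q s); rewrite wp.
- by have [-> _ _] := sigmaP (gwa_homog_z p q s); rewrite wm.
- by have [_ -> _] := sigmaP (gwa_homog_z p q s); rewrite w0.
by have [_ _ ->] := sigmaP (gwa_homog_z p q s); rewrite wp.
Qed.

Lemma sigma_x i s : sigma i (x s) = spow (twist i) s *: x s.
Proof. by rewrite sigmaE gwa_hom_x. Qed.

Lemma sigma_z i s : sigma i (z s) = spow (twist i) s *: z s.
Proof. by rewrite sigmaE gwa_hom_z. Qed.

Lemma sigma_gradeC (la mu : K) (la0 : la != 0) (mu0 : mu != 0) i a :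
  gwa_hom (@grade_quad K p q _ _ la0 mu0) (sigma i a)
  = sigma i (gwa_hom (@grade_quad K p q _ _ la0 mu0) a).
Proof.
move: a; apply: (gwa_lrmorph_ext (f := gwa_hom (@grade_quad K p q _ _ la0 mu0) \o sigma i)
                  (g := sigma i \o gwa_hom (@grade_quad K p q _ _ la0 mu0))) => s /=.
  by rewrite gwa_hom_x [RHS]linearZ /= sigma_x [LHS]linearZ /= gwa_hom_x !scalerA mulrC.
by rewrite gwa_hom_z [RHS]linearZ /= sigma_z [LHS]linearZ /= gwa_hom_z !scalerA mulrC.
Qed.

Definition tau i : {lrmorphism A -> A} :=
  gwa_hom (@grade_quad K p q _ _ (twistV_neq0 i) (twistV_neq0 i)).

Lemma tauK i : cancel (tau i) (sigma i).
Proof.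
apply: (gwa_lrmorph_ext (f := sigma i \o tau i) (g := idfun)) => s /=.
  by rewrite gwa_hom_x linearZ /= sigma_x scalerA spowVK ?twist_neq0 // scale1r.
by rewrite gwa_hom_z linearZ /= sigma_z scalerA spowVK ?twist_neq0 // scale1r.
Qed.

Lemma sigmaK i : cancel (sigma i) (tau i).
Proof.
by move=> a; exact: etrans (sigma_gradeC _ _ i a) (tauK i a).
Qed.

Lemma partialM i : skew_derivation (sigma i) (partial i).
Proof. by have [h _ _ _] := partialP. Qed.

Lemma partial_x t : partial (side t) (x t) = 0.
Proof. by have [_ _ [? ? ? ?] [? ? ? ?]] := partialP; case: t. Qed.

Lemma partial_z t : partial (side t) (z t) = 0.
Proof. by have [_ _ [? ? ? ?] [? ? ? ?]] := partialP; case: t. Qed.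

Lemma partial_zN t : partial (side t) (z (~~ t)) = alpha (side t) *: x t.
Proof. by have [_ _ [? ? ? ?] [? ? ? ?]] := partialP; case: t. Qed.

Lemma partial_xN t : partial (side t) (x (~~ t)) =
  alpha (side t) *: (horner_alg zz (q *: q2_deriv p q) * z t).
Proof. by have [_ _ [? ? ? ?] [? ? ? ?]] := partialP; case: t. Qed.

(** Both sides are skew derivations for sigma_0 with the same values on the
    generators. *)
Lemma partial0E a :
  partial idx0 a = (alpha idx0 / (q ^+ 2 - 1)) *: (sigma idx0 a - a).
Proof.
have q21 := q2_neq1 q_nroot.
have [_ [dxp dxm dzp dzm] _ _] := partialP.
have c1 : alpha idx0 / (q ^+ 2 - 1) * (q ^+ 2 - 1) = alpha idx0.
  by rewrite mulfVK.
have c2 : alpha idx0 / (q ^+ 2 - 1) * (q ^- 2 - 1) = - q ^- 2 * alpha idx0.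
  by field; rewrite q21 q_neq0.
have M (a0 b : A) : partial idx0 a0 = (alpha idx0 / (q ^+ 2 - 1)) *: (sigma idx0 a0 - a0) ->
    partial idx0 b = (alpha idx0 / (q ^+ 2 - 1)) *: (sigma idx0 b - b) ->
    partial idx0 (a0 * b) = (alpha idx0 / (q ^+ 2 - 1)) *: (sigma idx0 (a0 * b) - a0 * b).
  move=> Da Db; rewrite partialM Da Db -scalerAl -scalerAr -scalerDr rmorphM.
  by rewrite mulrBl mulrBr addrA subrK.
move: a; apply: gwa_ind => [|t a|t a|k a b IHa IHb].
- by rewrite (skew_one (partialM idx0)) rmorph1 subrr scaler0.
- apply: M; rewrite sigma_x scaler_sub1.
  by case: t; rewrite /= /twist /= ?c1 ?c2.
- apply: M; rewrite sigma_z scaler_sub1.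
  by case: t; rewrite /= /twist /= ?c1 ?c2.
rewrite [LHS]linearP /= IHa IHb [sigma idx0 (_ + _)]linearP /=.
exact: scaler_sub_comb.
Qed.

(** The derivation killing the generators of sign + has bidegree (1,1), the
    other one (-1,-1). *)
Lemma partial_grade (la mu : K) (la0 : la != 0) (mu0 : mu != 0) t a :
  gwa_hom (@grade_quad K p q _ _ la0 mu0) (partial (side t) a) =
    spow (la * mu) t *:
      partial (side t) (gwa_hom (@grade_quad K p q _ _ la0 mu0) a).
Proof.
have [slat smut] : spow la t != 0 /\ spow mu t != 0.
  by split; exact: spow_neq0.
move: a; apply: (skew_comm (partialM (side t))).
- exact: sigma_gradeC.
- move=> s /=; rewrite gwa_hom_x linearZ /=.
  case: (same_or_opp s t) => ->; first by rewrite partial_x rmorph0 !scaler0.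
  rewrite partial_xN linearZ rmorphM /= gwa_hom_z lrmorph_horner_alg /= grade_zz.
  by apply: scaler_balance_mul; rewrite spowM spowN; field.
move=> s /=; rewrite gwa_hom_z linearZ /=.
case: (same_or_opp s t) => ->; first by rewrite partial_z rmorph0 !scaler0.
rewrite partial_zN linearZ /= gwa_hom_x.
by apply: scaler_balance; rewrite spowM spowN; field.
Qed.

Lemma partial_tau t a :
  partial (side t) (tau (side t) a) = spow (q ^+ 2) t *: tau (side t) (partial (side t) a).
Proof.
have h := partial_grade (twistV_neq0 (side t)) (twistV_neq0 (side t)) t a.
have q2 : spow (q ^+ 2) t * spow ((twist (side t))^-1 * (twist (side t))^-1) t = 1.
  rewrite -invfM (_ : twist _ = q) -?expr2; last by case: (t).
  by rewrite -spowM mulfV ?expf_neq0 //; case: (t); rewrite /= ?invr1.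
by rewrite [X in _ = _ *: X]h scalerA q2 scale1r.
Qed.

Lemma partial0_tau a : partial idx0 (tau idx0 a) = tau idx0 (partial idx0 a).
Proof.
rewrite !partial0E [RHS]linearZ /=; congr (_ *: _).
rewrite [RHS]rmorphB /=; congr (_ - _).
exact: esym (sigma_gradeC _ _ _ _).
Qed.

Lemma gwa_zz_side t : z t * z (~~ t) = zz.
Proof. by case: t; [exact: erefl | exact/esym/gwa_zC]. Qed.

Lemma sigma_side_z t s : sigma (side t) (z s) = spow q s *: z s.
Proof. by rewrite sigma_z; case: t. Qed.

Lemma partial_mono t r m l :
  partial (side t) (x t ^+ r * (z t ^+ m * z (~~ t) ^+ l.+1)) =
    (alpha (side t) * spow q t ^+ m * sym_bracket (spow q t) l.+1)
      *: (x t ^+ r.+1 * (z t ^+ m * z (~~ t) ^+ l)).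
Proof.
apply: (skew_mono (s := sigma (side t))).
- exact: partialM.
- exact: spow_neq0.
- exact: spow_exp_neq1.
- exact: gwa_zx.
- exact: gwa_zx.
- by rewrite sigma_side_z spowN.
- exact: partial_x.
- exact: partial_z.
exact: partial_zN.
Qed.

Lemma sym_bracket_neq0 t l : sym_bracket (spow q t) l.+1 != 0.
Proof.
have k0 : spow q t != 0 by exact: spow_neq0.
have h j : (0 < j)%N -> spow q t ^+ j - spow q t ^- j != 0.
  move=> j0; rewrite subr_eq0; apply/eqP => kj.
  have /eqP := spow_exp_neq1 q_nroot t (leq_trans j0 (leq_addr j j)).
  by apply; rewrite exprD {1}kj mulVf // expf_neq0.
rewrite /sym_bracket mulf_neq0 ?invr_eq0 ?h //.
by have := h 1%N isT; rewrite expr1.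
Qed.

(** These are the only monomials whose image has a component in K[z]. *)
Lemma partial_Kz t m :
  partial (side t) (x (~~ t) * (z t ^+ m * z (~~ t) ^+ m.+1)) =
    (alpha (side t) * qeuler_scale q t m) *: horner_alg zz (qeuler q (p * 'X^m)).
Proof.
have zC : z t * z (~~ t) = z (~~ t) * z t.
  by case: (t); [exact: gwa_zC | exact/esym/gwa_zC].
have szn : sigma (side t) (z (~~ t)) = (spow q t)^-1 *: z (~~ t).
  by rewrite sigma_side_z spowN.
have xnxt : x (~~ t) * x t = horner_alg (z t * z (~~ t)) (xx_poly q p t).
  by rewrite gwa_zz_side; case: (t); rewrite ?gwa_xmxp ?gwa_xpxm.
have Dxn := partial_xN t; rewrite -[X in horner_alg X](gwa_zz_side t) in Dxn.
have k2 := spow_exp_neq1 q_nroot t (isT : 0 < 2)%N.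
rewrite (skew_Kz (partialM (side t)) (spow_neq0 t q_neq0) k2 (gwa_zx p q_neq0 t t)
  (gwa_zx p q_neq0 (~~ t) t) zC (sigma_side_z t t) szn (partial_x t) (partial_z t)
  (partial_zN t) xnxt Dxn m).
rewrite (qeuler_q2_deriv q_neq0 q_nroot) gwa_zz_side scalerA; exact: horner_algZ.
Qed.

(** * The image of the divergence *)

Lemma proj_partial0 a : proj (partial idx0 a) = 0.
Proof.
rewrite partial0E linearZ /= [gwa_proj _ _]linearB /= sigmaE proj_grade.
by rewrite subrr scaler0.
Qed.

(** The degree, in the x's and in the z's, that the derivation moves to 0. *)
Definition side_degree (t : bool) : int := if t then -1 else 1.

(** For the monomials of the wrong bidegree, some scaling of the x's or of the
    z's multiplies the image by a scalar other than 1, while it fixes K[z]. *)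
Lemma proj_partial_mono t e m l :
    ~~ ((e == side_degree t) && (m%:Z - l%:Z == side_degree t)) ->
  proj (partial (side t) (gwa_mono p q (e, m, l))) = 0.
Proof.
set u := gwa_mono p q (e, m, l).
have key (la mu : K) (la0 : la != 0) (mu0 : mu != 0) :
    spow (la * mu) t * (la ^ e * mu ^ (m%:Z - l%:Z)) != 1 ->
    proj (partial (side t) u) = 0.
  move=> ne1; have := proj_grade la0 mu0 q_neq0 (partial (side t) u).
  rewrite partial_grade grade_mono !linearZ /= scalerA => /eqP.
  rewrite -subr_eq0 -{2}[proj _]scale1r -scalerBl scaler_eq0 subr_eq0.
  by rewrite (negPf ne1) => /eqP.
have qz (n : int) : n != 0 -> q ^ n != 1.
  case: n => [[|n]|n] // _; first exact: q_nroot.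
  by rewrite NegzE -exprnN invr_eq1 q_nroot.
have qe (n : int) : n != side_degree t -> spow q t * q ^ n != 1.
  move=> ne; have -> : spow q t = q ^ (- side_degree t) by case: (t); rewrite /= ?exprN1.
  by rewrite -expfzDr // qz // addrC subr_eq0.
rewrite negb_and => /orP[ne|ne].
  by apply: (key q 1) => //; rewrite ?oner_eq0 // mulr1 exp1rz mulr1 qe.
by apply: (key 1 q) => //; rewrite ?oner_eq0 // mul1r exp1rz mul1r qe.
Qed.

Lemma proj_partial t a :
  exists f, proj (partial (side t) a) = qeuler q (p * f).
Proof.
have [s _ [c ->]] := gwa_mono_span q_neq0 a.
elim: s => [|[[e m] l] s [f IHs]].
  by exists 0; rewrite big_nil mulr0 !linear0.
rewrite big_cons linearP /= linearP /= IHs.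
suff [g ->] : exists g, proj (partial (side t) (gwa_mono p q (e, m, l))) = qeuler q (p * g).
  by exists (c (e, m, l) *: g + f); rewrite mulrDr -scalerAr [RHS]linearP.
case: (boolP ((e == side_degree t) && (m%:Z - l%:Z == side_degree t))); last first.
  by move/proj_partial_mono => ->; exists 0; rewrite mulr0 linear0.
move=> /andP[/eqP-> /eqP ml].
suff [j ->] : exists j, gwa_mono p q (side_degree t, m, l) =
    x (~~ t) * (z t ^+ j * z (~~ t) ^+ j.+1).
  rewrite partial_Kz linearZ /= gwa_proj_horner.
  exists ((alpha (side t) * qeuler_scale q t j) *: 'X^j).
  by rewrite -scalerAr [RHS]linearZ.
rewrite gwa_monoE; case: t {IHs} ml; rewrite /side_degree /= => ml.
  by exists m; rewrite expr1 (_ : l = m.+1) //; lia.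
by exists l; rewrite expr1 (_ : m = l.+1) /zmon ?gwa_zXC //; lia.
Qed.

Notation div := (gwa_div partial q : {linear rhom sigma -> A}).
Notation La := (coker_map div).

(** There is a linear form with any prescribed values on the omega_i. *)
Lemma Lambda_partial i b : La (partial i b) = 0.
Proof.
rewrite -(raddf0 La); apply/coker_map_eqP; rewrite subr0.
pose w : 'I_3 -> K := fun i => if i == idxm then q ^+ 2 else
  if i == idxp then q ^- 2 else 1.
exists (rhom_of sigmaK (fun j => if j == i then w i *: b else 0)).
have q2 : q ^+ 2 != 0 by rewrite expf_neq0.
rewrite /= /gwa_div !rhom_ofE.
move: i; apply: ord3_ind; rewrite /w /= !linear0 ?scaler0 ?addr0 ?add0r linearZ /=.
- by rewrite scalerA mulVf // scale1r.
- by rewrite scale1r.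
by rewrite scalerA mulfV // scale1r.
Qed.

Lemma Lambda_mono e m l : (e != 0) || (m != l) -> La (gwa_mono p q (e, m, l)) = 0.
Proof.
have lower t r i j : La (x t ^+ r.+1 * (z t ^+ i * z (~~ t) ^+ j)) = 0.
  have c0 : alpha (side t) * spow q t ^+ i * sym_bracket (spow q t) j.+1 != 0.
    by rewrite mulf_neq0 ?sym_bracket_neq0 // mulf_neq0 ?expf_neq0 ?spow_neq0.
  rewrite -[X in La X](scalerK c0) -partial_mono linearZ /= Lambda_partial.
  exact: scaler0.
have [->|e0 _] := eqVneq e 0; last first.
  case: e e0 => [[|r]|r] // _.
    by rewrite gwa_monoE; apply: (lower true).
  by rewrite gwa_monoE /zmon gwa_zXC; apply: (lower false).
(* A monomial in the z's alone is an eigenvector of partial_0. *)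
move=> ml0; have {ml0}ml : m != l by exact: ml0.
set u := gwa_mono _ _ _.
have su : sigma idx0 u = q ^ (2 * (m%:Z - l%:Z)) *: u.
  have tw : twist idx0 ^ (m%:Z - l%:Z) = q ^ (2 * (m%:Z - l%:Z)).
    by rewrite /twist /= [q ^+ 2]exprnP exprz_exp.
  by rewrite sigmaE grade_mono expr0z mul1r tw.
have qn : q ^ (2 * (m%:Z - l%:Z)) - 1 != 0.
  rewrite subr_eq0; have : 2 * (m%:Z - l%:Z) != 0 by lia.
  by case: (2 * _) => [[|k]|k] //; rewrite ?NegzE -?exprnN ?invr_eq1 -?exprnP q_nroot.
have c0 : alpha idx0 / (q ^+ 2 - 1) * (q ^ (2 * (m%:Z - l%:Z)) - 1) != 0.
  by rewrite !mulf_neq0 ?invr_eq0 ?alpha_neq0 ?q2_neq1.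
have uE : partial idx0 u = (alpha idx0 / (q ^+ 2 - 1) * (q ^ (2 * (m%:Z - l%:Z)) - 1)) *: u.
  by rewrite (partial0E u) su; exact: scaler_sub1.
by rewrite -[X in La X](scalerK c0) -uE linearZ /= Lambda_partial scaler0.
Qed.

Definition Lambda_poly (f : {poly K}) : coker div := La (horner_alg zz f).

Fact Lambda_poly_linear : linear Lambda_poly.
Proof.
by move=> k f g; rewrite /Lambda_poly rmorphD /= horner_algZ linearP.
Qed.

HB.instance Definition _ :=
  GRing.isLinear.Build K {poly K} (coker div) *:%R Lambda_poly Lambda_poly_linear.

Lemma Lambda_polyXn k : Lambda_poly 'X^k = La (zz ^+ k).
Proof. by rewrite /Lambda_poly rmorphXn /= horner_algX. Qed.

Lemma Lambda_qeuler f : Lambda_poly (qeuler q (p * f)) = 0.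
Proof.
rewrite -[f]coefK poly_def mulr_sumr !linear_sum big1 // => i _.
rewrite -scalerAr !linearZ /=.
suff -> : Lambda_poly (qeuler q (p * 'X^i)) = 0 by rewrite scaler0.
have c0 : alpha (side true) * qeuler_scale q true i != 0.
  by rewrite mulf_neq0 ?qeuler_scale_neq0.
rewrite /Lambda_poly -[X in La X](scalerK c0) -partial_Kz linearZ /=.
by rewrite Lambda_partial scaler0.
Qed.

Lemma proj_div f : exists g, proj (div f) = qeuler q (p * g).
Proof.
have [gm gmE] := proj_partial true (f (omega A idxm)).
have [gp gpE] := proj_partial false (f (omega A idxp)).
exists (q ^- 2 *: gm + q ^+ 2 *: gp).
rewrite /= /gwa_div linearD linearD /= !linearZ /= proj_partial0 gmE gpE addr0.
by rewrite mulrDr -!scalerAr [RHS]linearD /= !linearZ.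
Qed.

(** A relation between the v_i says that a polynomial of degree less than n,
    evaluated at z, is a divergence; its projection is then in Q((p)). *)
Lemma Lambda_free (n := (size p).-1) (s : seq 'I_n) (c : 'I_n -> K) : p != 0 ->
  uniq s -> \sum_(i <- s) c i *: La (zz ^+ i) = 0 -> {in s, forall i, c i = 0}.
Proof.
move=> p0 us s0; pose P : {poly K} := \sum_(i <- s) c i *: 'X^i.
have PE (j : nat) : P`_j = \sum_(i <- s) c i * (j == i)%:R.
  by rewrite coef_sum; apply: eq_bigr => i _; rewrite coefZ coefXn.
have : Lambda_poly P = 0.
  by rewrite -[RHS]s0 linear_sum; apply: eq_bigr => i _; rewrite linearZ /= Lambda_polyXn.
rewrite -(raddf0 La) => /coker_map_eqP[f]; rewrite subr0 => Pf.
have [g gE] := proj_div f; rewrite -Pf gwa_proj_horner in gE.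
have P0 : P = 0.
  apply: (qeuler_multiple_small q_nroot p0 _ gE) => j nj.
  rewrite PE big1 // => i _; case: eqP => [ji|_]; last by rewrite mulr0.
  by have := ltn_ord i; rewrite -ji ltnNge nj.
move=> i si; have := PE i; rewrite P0 coef0 (bigD1_seq i) //= eqxx mulr1.
rewrite big1 ?addr0 // => j ji; rewrite -val_eqE eq_sym in ji.
by rewrite (negPf ji) mulr0.
Qed.

Lemma Lambda_qeulerXn j :
  (Lambda_poly \o qeuler q) 'X^j = (q ^+ (2 * j.+1) - 1) *: La (zz ^+ j).
Proof. by rewrite /= qeulerXn linearZ /= Lambda_polyXn. Qed.

Lemma Lambda_basis : p != 0 ->
  linear_basis (fun i : 'I_(size p).-1 => La (zz ^+ i)).
Proof.
move=> p0; split=> [s c us s0|v]; first exact: Lambda_free s0.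
have [a ->] := coker_map_surj v.
suff [s _ [c ->]] : spanned (fun i : 'I_(size p).-1 => La (zz ^+ i)) (La a) by exists s, c.
apply: (spanned_linear (f := La)) (gwa_mono_span q_neq0 a) => -[[e m] l].
have [/andP[/eqP-> /eqP->]|] := boolP ((e == 0) && (m == l)); last first.
  rewrite negb_and => ml; rewrite [X in spanned _ X](Lambda_mono ml).
  exact: spanned0.
rewrite -[X in spanned _ X]/(La (gwa_mono p q (0, l, l))) gwa_mono_zz.
exact: (q_span (v := fun j => La (zz ^+ j)) q_nroot p0 Lambda_qeulerXn Lambda_qeuler).
Qed.

End Calculus.

Theorem proposition4p7 (K : fieldType) (p : {poly K}) (q : K)
    (alpha : 'I_3 -> K)
    (sigma : 'I_3 -> {lrmorphism gwa p q -> gwa p q})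
    (partial : 'I_3 -> {linear gwa p q -> gwa p q})
    (charK : [pchar K] =i pred0)
    (q_neq0 : q != 0)
    (q_nroot : forall k : nat, (0 < k)%N -> q ^+ k != 1)
    (p_sep : q2_separable p q)
    (alpha_neq0 : forall i, alpha i != 0)
    (sigmaP : gwa_twists sigma)
    (partialP : gwa_derivations alpha sigma partial) :
  let n := (size p).-1 in
  let z := gwa_zz p q in
  let div : {linear rhom sigma -> gwa p q} := gwa_div partial q in
  let Lambda : {linear gwa p q -> coker div} := coker_map div in
  [/\ (exists! xi : 'I_3 -> rhom sigma, dual_basis xi) /\
      (forall xi : 'I_3 -> rhom sigma, dual_basis xi ->
        [/\ is_divergence partial div,
            forall i, div (xi i) = 0
          & forall div' : {linear rhom sigma -> gwa p q},
              is_divergence partial div' -> (forall i, div' (xi i) = 0) ->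
              forall f, div' f = div f]),
      [/\ linear_basis (@gwa_mono K p q),
          forall u, gwa_in_Kz (gwa_mono p q u) ->
            exists k : nat, gwa_mono p q u = z ^+ k,
          forall u, ~ gwa_in_Kz (gwa_mono p q u) -> Lambda (gwa_mono p q u) = 0
        & forall f : {poly K},
            Lambda (horner_alg z (q ^+ 2 *: ((p \Po (q ^+ 2 *: 'X))
                                             * (f \Po (q ^+ 2 *: 'X)))))
            = Lambda (horner_alg z (p * f))]
    & linear_basis (fun i : 'I_n => Lambda (z ^+ i)) /\
      (forall (mu : int -> K) (beta : nat -> int -> K),
        (lead_coef p)^-1 *: p = 'X^n - \sum_(i < n) mu i%:Z *: 'X^i ->
        (forall l : int, l < 0 -> mu l = 0) ->
        (forall (i : nat) (l : int), (i < n)%N -> l < 0 -> beta i l = 0) ->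
        (forall i k : nat, (i < n)%N ->
          beta i k%:Z = \sum_(1 <= j < n.+1) mu (n%:Z - j%:Z) * beta i (k%:Z - j%:Z)
                        + mu (i%:Z - k%:Z)) ->
        forall k : nat,
          Lambda (z ^+ (n + k)) =
            \sum_(i < n) (q2_bracket q i.+1 / q2_bracket q (n + k).+1 * beta i k%:Z)
                         *: Lambda (z ^+ i))].
Proof.
move=> n z div Lambda.
have p0 : p != 0.
  apply/eqP => pE; move: p_sep; rewrite /q2_separable pE /coprimep gcd0p.
  by rewrite /q2_deriv comp_poly0 subrr div0p mulr0 size_poly0.
have dM := partialM partialP.
have sK := sigmaK q_neq0 sigmaP.
have tK := tauK q_neq0 sigmaP.
have LaE := Lambda_qeuler q_neq0 q_nroot alpha_neq0 sigmaP partialP.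
split.
- split=> [|xi xiP]; first exact: (dual_basis_exists sK tK).
  have divP : is_divergence partial div.
    apply: (div_divergence tK dM) => //.
    + exact: (partial_tau q_neq0 sigmaP partialP true).
    + exact: (partial0_tau q_neq0 q_nroot sigmaP partialP).
    exact: (partial_tau q_neq0 sigmaP partialP false).
  have divxi i : div (xi i) = 0 by exact: (div_dual_basis q dM i xiP).
  split=> // div' div'P div'xi.
  exact: (divergence_unique sK tK xiP divP div'P divxi div'xi).
- split=> [|[[e m] l]|[[e m] l] notKz|f].
  + exact: gwa_mono_basis.
  + case/(gwa_mono_in_Kz q_neq0 p0)/andP=> /eqP-> /eqP->.
    by exists l; exact: gwa_mono_zz.
  + apply: (Lambda_mono q_neq0 q_nroot alpha_neq0 sigmaP partialP).
    rewrite -negb_and; apply/negP => /andP[/eqP e0 /eqP ml]; apply: notKz.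
    by exists 'X^l; rewrite e0 ml gwa_mono_zz rmorphXn /= horner_algX.
  apply/eqP; rewrite -subr_eq0 -raddfB -rmorphB -dilateM.
  exact/eqP/LaE.
split; first exact: (Lambda_basis q_neq0 q_nroot alpha_neq0 sigmaP partialP).
move=> mu beta muE mu_neg beta_neg beta_rec k.
exact: (q_recurrence (v := fun j => Lambda (z ^+ j)) q_nroot p0
  (Lambda_qeulerXn sigma partial) LaE muE mu_neg beta_neg beta_rec).
Qed.
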